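(* Let $\nu$ be a symmetric Lévy measure on $\mathbb{R}^d\setminus\{0\}$ and let $\{\mu_t:\,t\ge 0\}$ be the convolution semigroup of probability measures on $\mathbb{R}^d$ such that $\int_{\mathbb{R}^d}e^{i\xi\cdot y}\,\mu_t(dy)=\exp(-t\Psi(\xi))$, where $$\Psi(\xi)=\int_{\mathbb{R}^d\setminus\{0\}}\left(1-\cos(\xi\cdot y)\right)\nu(dy),\quad\xi\in\mathbb{R}^d.$$ Assume that $\int_{\mathbb{R}^d}e^{-t\Psi(z)}\,dz<\infty$ for all $t>0$, and let $p_t$ denote the continuous density of $\mu_t$, $t>0$. Let $\xi_0\in\mathbb{R}^d$ be arbitrary. If $$\int_{|y|\ge 1}e^{\xi_0\cdot y}\,\nu(dy)<\infty,$$ then $$p_t(x)\le p_t(0)\,e^{-\xi_0\cdot x+t\omega(\xi_0)},\quad x\in\mathbb{R}^d,\ t>0.$$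
   Context: A symmetric Lévy measure is a Radon measure $\nu$ on $\mathbb{R}^d\setminus\{0\}$ with $\nu(B)=\nu(-B)$ for Borel sets $B$ and $\int(1\wedge|y|^2)\,\nu(dy)<\infty$. The integrability of $e^{-t\Psi}$ guarantees that $\mu_t$ has a bounded continuous density, $p_t(x)=(2\pi)^{-d}\int e^{-t\Psi(\xi)}e^{i x\cdot\xi}\,d\xi$. The function $\omega$ is defined by $$\omega(\xi)=\int_{\mathbb{R}^d\setminus\{0\}}\left(\cosh(\xi\cdot y)-1\right)\nu(dy)$$ for all $\xi\in\mathbb{R}^d$ for which the integral is finite. *)

(* Defs.v *)
From HB Require Import structures.
From mathcomp Require Import all_boot all_order all_algebra.
From mathcomp Require Import all_classical all_reals all_analysis.
From mathcomp Require Import measurable_realfun complex lra.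
Set Implicit Arguments.
Unset Strict Implicit.
Unset Printing Implicit Defensive.
Import Order.TTheory GRing.Theory Num.Theory.
Import numFieldNormedType.Exports.

Local Open Scope classical_set_scope.
Local Open Scope ring_scope.

(* R^d is 'rV[R]_d, with the Borel sigma-algebra of its library topology
   (the one of the sup norm, i.e. the usual one). *)
Section borel_rV.
Context (R : realType) (d : nat).

HB.instance Definition _ := @isMeasurable.Build
  (sigma_display (@open 'rV[R]_d)) 'rV[R]_d
  <<s @open 'rV[R]_d >> (@sigma_algebra0 _ setT _)
  (@sigma_algebraC _ _) (@sigma_algebra_bigcup _ setT _).

End borel_rV.

Section measurability_rV.
Context (R : realType) (d : nat).

Lemma measurable_coord_rV (i : 'I_d) :
  measurable_fun [set: 'rV[R]_d] (fun v : 'rV[R]_d => v 0 i).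
Proof.
apply: (measurability _ (RGenOpens.measurableE R)) => //.
move=> _ [_ [a [b ->]] <-]; rewrite setTI.
apply: sub_sigma_algebra.
by apply: open_comp; [move=> v _; exact: coord_continuous|exact: interval_open].
Qed.

Lemma measurable_fun_rV d1 (T : measurableType d1) (f : T -> 'rV[R]_d) :
  (forall i, measurable_fun [set: T] (fun t => f t 0 i)) ->
  measurable_fun [set: T] f.
Proof.
move=> mf.
apply: (@measurability _ _ _ _ setT f (@open 'rV[R]_d)) => //.
move=> _ [U oU <-]; rewrite setTI.
pose box (q : 'rV[rat]_d * nat) : set 'rV[R]_d :=
  [set v | forall i, v 0 i \in
     `](ratr (q.1 0 i) - q.2.+1%:R^-1), (ratr (q.1 0 i) + q.2.+1%:R^-1)[].
have -> : f @^-1` U = \bigcup_(q in [set q | box q `<=` U]) f @^-1` (box q).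
  rewrite -preimage_bigcup; congr (_ @^-1` _); apply/seteqP; split; last first.
    by move=> v [q /= + qv]; exact.
  move=> v Uv; have /nbhs_ballP[e /= e0 eU] := open_nbhs_nbhs (conj oU Uv).
  have e20 : 0 < e / 2 by rewrite divr_gt0.
  have [N /ltW Ne] : exists N : nat, (N.+1%:R : R)^-1 < e / 2.
    have [N N0 /(_ N (leqnn N))] := near_infty_natSinv_lt (PosNum e20).
    by exists N.
  have [q qP] : exists q : 'rV[rat]_d, forall i, ratr (q 0 i) \in
      `](v 0 i - N.+1%:R^-1), (v 0 i + N.+1%:R^-1)[.
    have H i : exists r : rat, (ratr r : R) \in
        `](v 0 i - N.+1%:R^-1), (v 0 i + N.+1%:R^-1)[.
      by apply: rat_in_itvoo; rewrite ltrBlDr -addrA ltrDl addr_gt0// invr_gt0.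
    have /choice[g gP] := H.
    by exists (\row_i g i) => i; rewrite mxE.
  exists (q, N) => /=.
    move=> w /= wq; apply: eU; split => // i j; rewrite (ord1 i).
    move: (wq j) (qP j); rewrite !in_itv/= /ball/= => /andP[a1 a2] /andP[b1 b2].
    rewrite ltr_norml.
    move: (ratr _) (_^-1) a1 a2 b1 b2 Ne => r s a1 a2 b1 b2 Ne.
    by apply/andP; split; lra.
  move=> i /=; move: (qP i); rewrite !in_itv/=.
  by move: (ratr _) (_^-1) => r s /andP[b1 b2]; apply/andP; split; lra.
rewrite bigcup_mkcond; apply: (countable_bigcupT_measurable (countableP _)) => q.
case: ifP => _; last exact: measurable0.
have -> : f @^-1` box q =
    \bigcap_(i in [set: 'I_d]) [set t | f t 0 i \in
     `](ratr (q.1 0 i) - q.2.+1%:R^-1), (ratr (q.1 0 i) + q.2.+1%:R^-1)[].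
  by apply/seteqP; split=> [t tq i _|t tq i]; exact: tq.
apply: fin_bigcap_measurable => // i _.
have := mf i measurableT [set` `](ratr (q.1 0 i) - q.2.+1%:R^-1),
  (ratr (q.1 0 i) + q.2.+1%:R^-1)[] (measurable_itv _).
by rewrite setTI.
Qed.

End measurability_rV.

Section lebesgue_rV.
Context (R : realType).

Definition cons_rV d (p : R * 'rV[R]_d) : 'rV[R]_d.+1 :=
  \row_i (if unlift ord0 i is Some j then p.2 0 j else p.1).

Definition uncons_rV d (v : 'rV[R]_d.+1) : R * 'rV[R]_d :=
  (v 0 ord0, \row_j v 0 (lift ord0 j)).

Lemma cons_rVK d : cancel (@cons_rV d) (@uncons_rV d).
Proof.
move=> [x v]; rewrite /uncons_rV /cons_rV mxE unlift_none /=; congr pair.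
by apply/rowP => j; rewrite !mxE liftK.
Qed.

Lemma measurable_cons_rV d :
  measurable_fun [set: measurableTypeR R * 'rV[R]_d] (@cons_rV d).
Proof.
apply: measurable_fun_rV => i.
under eq_fun do rewrite mxE.
case: unliftP => [j|] _; last exact: measurable_fst.
exact: (measurableT_comp (measurable_coord_rV _) measurable_snd).
Qed.

Lemma measurable_uncons_rV d :
  measurable_fun [set: 'rV[R]_d.+1]
    (@uncons_rV d : _ -> measurableTypeR R * 'rV[R]_d).
Proof.
apply: measurable_fun_pair; first exact: measurable_coord_rV.
apply: measurable_fun_rV => i.
by under eq_fun do rewrite mxE; exact: measurable_coord_rV.
Qed.

Section step.
Variables (d : nat) (m : {sigma_finite_measure set 'rV[R]_d -> \bar R}).

Definition lebesgue_rV_step : set 'rV[R]_d.+1 -> \bar R :=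
  pushforward (@lebesgue_measure R \x m)%E
    (@cons_rV d : measurableTypeR R * 'rV[R]_d -> _).

Let step0 : lebesgue_rV_step set0 = 0%E.
Proof. by rewrite /lebesgue_rV_step /pushforward preimage_set0 measure0. Qed.

Let step_ge0 A : (0 <= lebesgue_rV_step A)%E.
Proof. by rewrite /lebesgue_rV_step /pushforward measure_ge0. Qed.

Let step_sigma_additive : semi_sigma_additive lebesgue_rV_step.
Proof.
have mcons A : measurable A -> measurable (@cons_rV d @^-1` A).
  by move=> mA; have := measurable_cons_rV measurableT mA; rewrite setTI.
move=> F mF tF mUF; rewrite /lebesgue_rV_step /pushforward preimage_bigcup.
apply: measure_semi_sigma_additive.
- by move=> n; exact: mcons.
- apply/trivIsetP => i j _ _ ij; rewrite -preimage_setI.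
  by move/trivIsetP : tF => /(_ _ _ _ _ ij) ->//; rewrite preimage_set0.
- by rewrite -preimage_bigcup; exact: mcons.
Qed.

HB.instance Definition _ := isMeasure.Build _ _ _ lebesgue_rV_step
  step0 step_ge0 step_sigma_additive.

Let step_sigma_finite : sigma_finite setT lebesgue_rV_step.
Proof.
have /sigma_finiteP[F [TF ndF Foo]] := sigma_finiteT (@lebesgue_measure R).
have /sigma_finiteP[G [TG ndG Goo]] := sigma_finiteT m.
exists (fun n => @uncons_rV d @^-1` (F n `*` G n)).
  rewrite -preimage_bigcup (_ : \bigcup_n _ = setT) ?preimage_setT//.
  apply/seteqP; split => // -[x v] _.
  have [i _ Fx] : (\bigcup_i F i) x by rewrite -TF.
  have [j _ Gv] : (\bigcup_i G i) v by rewrite -TG.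
  exists (maxn i j) => //; split => /=.
    by move: x Fx; exact/subsetPset/ndF/leq_maxl.
  by move: v Gv; exact/subsetPset/ndG/leq_maxr.
move=> n; have [mF Fn] := Foo n; have [mG Gn] := Goo n.
have mFG := measurableX mF mG; split.
  by have := measurable_uncons_rV measurableT mFG; rewrite setTI.
rewrite /lebesgue_rV_step /pushforward (_ : _ @^-1` _ = F n `*` G n).
  by rewrite product_measure1E// lte_mul_pinfty// ge0_fin_numE.
by rewrite -comp_preimage (_ : _ \o _ = id)//; apply/funext => p; exact: cons_rVK.
Qed.

HB.instance Definition _ := Measure_isSigmaFinite.Build _ _ _
  lebesgue_rV_step step_sigma_finite.

End step.

Fixpoint lebesgue_rV d : {sigma_finite_measure set 'rV[R]_d -> \bar R} :=
  if d is d'.+1 then lebesgue_rV_step (lebesgue_rV d')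
  else \d_(0 : 'rV[R]_0).

Lemma lebesgue_rV_box d (A : 'I_d -> set (measurableTypeR R)) :
  (forall i, measurable (A i)) ->
  lebesgue_rV d [set v | forall i, A i (v 0 i)] =
    (\prod_i @lebesgue_measure R (A i))%E.
Proof.
elim: d A => [|d IH] A mA.
  by rewrite big_ord0 /= diracE mem_set// => -[].
pose B : set 'rV[R]_d := [set v | forall i, A (lift ord0 i) (v 0 i)].
have mB : measurable B.
  rewrite (_ : B = \bigcap_(i in [set: 'I_d])
      [set v : 'rV[R]_d | A (lift ord0 i) (v 0 i)]).
    apply: fin_bigcap_measurable => // i _.
    by have := @measurable_coord_rV R d i measurableT _ (mA (lift ord0 i));
      rewrite setTI.
  by apply/seteqP; split => [v h i _|v h i]; exact: h.
rewrite big_ord_recl -IH// -(product_measure1E _ _ (mA ord0) mB).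
congr (product_measure1 _ _ _); apply/seteqP; split => -[x v] /= h.
  split; first by have := h ord0; rewrite mxE unlift_none.
  by move=> i; have := h (lift ord0 i); rewrite mxE liftK.
by move=> i; rewrite mxE; case: unliftP => [j ->|->]; [exact: h.2|exact: h.1].
Qed.

End lebesgue_rV.

Section complex_integral.
Context (R : realType).

Definition expi (u : R) : R[i] := Complex (cos u) (sin u).

Definition complex_integral d (T : measurableType d)
    (m : {measure set T -> \bar R}) (f : T -> R[i]) : R[i] :=
  Complex (\int[m]_x complex.Re (f x)) (\int[m]_x complex.Im (f x)).

End complex_integral.

Section levy.
Context (R : realType) (d : nat).
Implicit Types (x y xi : 'rV[R]_d) (A B K : set 'rV[R]_d).

Definition dotp x y : R := \sum_i x 0 i * y 0 i.

(* The library's norm on 'rV[R]_d is the sup norm. *)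
Definition enorm x : R := Num.sqrt (dotp x x).

Definition cosh (u : R) : R := (expR u + expR (- u)) / 2.

(* A measure on R^d \ {0} is identified with its extension to R^d that does
   not charge the origin; the compact subsets of R^d \ {0} are the compact
   subsets of R^d that avoid the origin. *)
Definition radon_punctured (nu : {measure set 'rV[R]_d -> \bar R}) : Prop :=
  [/\ nu [set 0] = 0%E,
      forall K, compact K -> ~ K 0 -> (nu K < +oo)%E
    & forall B, measurable B -> ~ B 0 ->
        nu B = ereal_sup [set nu K | K in [set K | compact K /\ K `<=` B]]].

Definition symmetric_levy_measure
    (nu : {measure set 'rV[R]_d -> \bar R}) : Prop :=
  [/\ radon_punctured nu,
      forall B, measurable B -> ~ B 0 -> nu B = nu [set - y | y in B]
    & (\int[nu]_(y in ~` [set 0%R]) (Num.min 1 (enorm y ^+ 2))%:E < +oo)%E].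

(* Rintegral is 0 when the integral of a nonnegative function is infinite:
   levy_exponent is meaningful when nu is a symmetric Levy measure, and
   levy_omega at those xi for which the integral is finite. *)
Definition levy_exponent (nu : {measure set 'rV[R]_d -> \bar R}) xi : R :=
  \int[nu]_(y in ~` [set 0]) (1 - cos (dotp xi y)).

Definition levy_omega (nu : {measure set 'rV[R]_d -> \bar R}) xi : R :=
  \int[nu]_(y in ~` [set 0]) (cosh (dotp xi y) - 1).

Definition convolution (m1 m2 : probability 'rV[R]_d R) A : \bar R :=
  (m1 \x m2)%E [set p | A (p.1 + p.2)].

Definition convolution_semigroup (mu : R -> probability 'rV[R]_d R) : Prop :=
  [/\ forall A, measurable A -> mu 0 A = \d_(0 : 'rV[R]_d) A,
      forall s t A, 0 <= s -> 0 <= t -> measurable A ->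
        mu (s + t) A = convolution (mu s) (mu t) A
    & forall f : 'rV[R]_d -> R, continuous f ->
        (exists M, forall x, `|f x| <= M) ->
        \int[mu t]_x f x @[t --> 0^'+] --> f 0].

Definition continuous_density (m : probability 'rV[R]_d R)
    (f : 'rV[R]_d -> R) : Prop :=
  [/\ continuous f, forall x, 0 <= f x
    & forall A, measurable A ->
        m A = (\int[lebesgue_rV R d]_(x in A) (f x)%:E)%E].

End levy.

(* Main.v *)
Require Import Defs.
From HB Require Import structures.
From mathcomp Require Import all_boot all_order all_algebra.
From mathcomp Require Import all_classical all_reals all_analysis.
From mathcomp Require Import complex measurable_realfun ring lra.
Import Order.TTheory GRing.Theory Num.Theory.
Import numFieldNormedType.Exports.
Local Open Scope classical_set_scope.
Local Open Scope ring_scope.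

Set Implicit Arguments.
Unset Strict Implicit.
Unset Printing Implicit Defensive.

(* Fix s > 0 and let M be the centred Gaussian law on R^d with covariance s^2,
   whose characteristic function is g(x) = exp(- s^2 |x|^2 / 2). Completing the
   square gives g(x) = K e^{- xi0.x} g(x - xi0 / s^2) with K = exp(|xi0|^2 / (2 s^2)).
   If lam is a finite symmetric measure, integrating translates of this identity
   against lam shows that it survives when the integrand of g is multiplied on
   the left by 1 - sigma Psi(xi) and on the right by the complex number
   1 + sigma int (e^{xi0.y} e^{i xi.y} - 1) lam(dy). Iterating k times with
   sigma = t / k and letting k tend to infinity gives, after bounding the right
   side by its modulus and using cosh u cos v - 1 <= (cosh u - 1) - (1 - cos v),
     int cos(xi.x) e^{- t Psi(xi)} dM <= K e^{- xi0.x + t omega(xi0)} int e^{- t Psi(xi)} dM.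
   So the contour shift is done by a polynomial identity: no analytic
   continuation is needed. The inequality passes to nu by restricting nu to
   |y| >= 1/n, and by Fubini it compares mu_t * g at x and at 0. As s tends to
   infinity, g becomes an approximate identity and K tends to 1. *)

(** Formally, the contour of the inversion integral is moved from xi to xi - i xi0, where e^{- t
    Psi} becomes e^{t theta} with theta(xi) = int (e^{xi0.y} e^{i xi.y} - 1) nu(dy). The Gaussian
    weight alone allows this by completing the square. A factor 1 - sigma Psi is, on the side of x,
    the identity plus sigma times the operator f -> int (f(x - y) - f(x)) lam(dy); this commutes
    with translations, and conjugating it by e^{- xi0.x} only inserts the weight e^{xi0.y} in front
    of f(x - y). Euler powers are finite compositions of such operators, so the identity propagates
    by induction. Finiteness of the measure makes Psi and theta bounded, so that every use of Fubini
    is dominated. The translation by xi0 / s^2 left over on the right disappears once the modulus is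
    taken. M lives on the frequencies and its characteristic function g smooths p_t; g need not be
    normalised, because the same mass of g near its centre appears at x and at 0 and cancels. *)

Section measure_tools.
Context (R : realType).

(** * Integrability, densities, image measures and Fubini for real integrands *)

Lemma bounded_integrable d (T : measurableType d) (m : {measure set T -> \bar R})
    (f : T -> R) (c : R) : (m setT < +oo)%E -> measurable_fun setT f ->
  (forall x, `|f x| <= c) -> m.-integrable setT (EFin \o f).
Proof.
move=> mT mf fc; apply: measurable_bounded_integrable => //.
exists c; split; first exact: num_real.
by move=> y cy x _ /=; apply: le_trans (fc x) (ltW cy).
Qed.

Section real_integrable.
Context d (T : measurableType d) (m : {measure set T -> \bar R}).
Implicit Types f g : T -> R.

Lemma integrable_addr f g : m.-integrable setT (EFin \o f) ->
  m.-integrable setT (EFin \o g) ->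
  m.-integrable setT (EFin \o (fun x => f x + g x)).
Proof. by move=> intf intg; exact: (integrableD _ intf intg). Qed.

Lemma integrable_subr f g : m.-integrable setT (EFin \o f) ->
  m.-integrable setT (EFin \o g) ->
  m.-integrable setT (EFin \o (fun x => f x - g x)).
Proof. by move=> intf intg; exact: (integrableB _ intf intg). Qed.

Lemma integrable_mulrl k f : m.-integrable setT (EFin \o f) ->
  m.-integrable setT (EFin \o (fun x => k * f x)).
Proof. by move=> intf; exact: (integrableZl _ k intf). Qed.

End real_integrable.

Lemma dominated_integrable d (T : measurableType d) (m : {measure set T -> \bar R})
    (f g : T -> R) : measurable_fun setT f -> m.-integrable setT (EFin \o g) ->
  (forall x, `|f x| <= g x) -> m.-integrable setT (EFin \o f).
Proof.
move=> mf ig fg; apply: (le_integrable _ _ _ ig) => //; first exact/measurable_EFinP.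
by move=> x _ /=; rewrite lee_fin (le_trans (fg x))// ler_norm.
Qed.

Import HBNNSimple.

(** Simple functions and monotone convergence reduce the formula to indicators, where it is the
    hypothesis. No finiteness is imposed on [m], so that a Levy measure can take its place. *)
Lemma integral_density d (T : measurableType d) (m m' : {measure set T -> \bar R})
    (g : T -> R) : measurable_fun setT g -> (forall x, 0 <= g x) ->
  (forall A, measurable A -> m' A = (\int[m]_(x in A) (g x)%:E)%E) ->
  forall (f : T -> R), measurable_fun setT f -> (forall x, 0 <= f x) ->
  (\int[m']_x (f x)%:E = \int[m]_x (f x * g x)%:E)%E.
Proof.
move=> mg g0 m'E f mf f0.
have mEf : measurable_fun setT (EFin \o f) by exact/measurable_EFinP.
pose h := nnsfun_approx measurableT mEf.
have mh n : measurable_fun setT (h n) by exact: measurable_funP.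
have ndh x : {homo h ^~ x : a b / (a <= b)%N >-> a <= b}.
  by move=> a b ab; exact/lefP/nd_nnsfun_approx.
have hf x : (h n x)%:E @[n --> \oo] --> (f x)%:E.
  by apply: (cvg_nnsfun_approx measurableT mEf) => // y _; rewrite lee_fin.
transitivity (limn (fun n => \int[m']_x (h n x)%:E))%E.
  rewrite -monotone_convergence//.
  - by apply: eq_integral => x _; apply/esym/cvg_lim => //; exact: hf.
  - by move=> n; exact/measurable_EFinP.
  - by move=> n x _; rewrite lee_fin.
  - by move=> x _ a b ab; rewrite lee_fin; exact: ndh.
transitivity (limn (fun n => \int[m]_x (h n x * g x)%:E))%E; last first.
  rewrite -monotone_convergence//.
  - apply: eq_integral => x _; apply/cvg_lim => //.
    under eq_fun do rewrite EFinM.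
    by rewrite EFinM; apply: cvgeZr => //; exact: hf.
  - by move=> n; exact/measurable_EFinP/measurable_funM.
  - by move=> n x _; rewrite lee_fin mulr_ge0.
  - by move=> x _ a b ab; rewrite lee_fin ler_wpM2r//; exact: ndh.
congr (limn _); apply/funext => n.
have mA r : measurable (h n @^-1` [set r]) by exact: measurable_sfunP.
under eq_integral do rewrite fimfunE -fsumEFin//.
rewrite ge0_integral_fsum//; last 2 first.
- by move=> r; exact/measurable_EFinP/measurable_funM.
- by move=> r x _; exact: nnfun_muleindic_ge0.
under [RHS]eq_integral => x _.
  rewrite EFinM {1}fimfunE -fsumEFin// ge0_mule_fsuml; last first.
    by move=> r; exact: nnfun_muleindic_ge0.
  over.
rewrite [RHS]ge0_integral_fsum//; last 2 first.
- move=> r; apply/emeasurable_funM; last exact/measurable_EFinP.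
  exact/measurable_EFinP/measurable_funM.
- by move=> r x _; rewrite mule_ge0 ?nnfun_muleindic_ge0// lee_fin.
apply: eq_fsbigr => r _.
rewrite integralZl_indic_nnsfun// integral_indic// setIT m'E//.
(* Membership of [r] in the range of [h n] was discarded, so negative [r] have to be treated: their
   preimage is empty and both sides vanish. *)
have [r0|r0] := ltP r 0; first by rewrite preimage_nnfun0// integral_set0 mule0
  integral0_eq// => x _; rewrite indicE in_set0 mulr0 mul0e.
rewrite integral_mkcond -ge0_integralZl//=; last 2 first.
- have := (measurable_restrictT (fun y => (g y)%:E) (mA r)).1; apply.
  exact/measurable_funTS/measurable_EFinP.
- by move=> x _; rewrite erestrict_ge0// => y _; rewrite lee_fin.
apply: eq_integral => x _; rewrite patchE indicE EFinM -muleA.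
by case: ifP => _; rewrite ?mul1e ?mul0e ?mule0.
Qed.

(** The nonnegative case applies to [f + 1] and to 1; subtracting one from the other leaves the
    signed [f]. *)
Lemma Rintegral_density d (T : measurableType d) (m m' : {measure set T -> \bar R})
    (g : T -> R) : measurable_fun setT g -> (forall x, 0 <= g x) ->
  (forall A, measurable A -> m' A = (\int[m]_(x in A) (g x)%:E)%E) ->
  (m' setT < +oo)%E ->
  forall (f : T -> R), measurable_fun setT f -> (forall x, `|f x| <= 1) ->
  \int[m']_x f x = \int[m]_x (f x * g x).
Proof.
move=> mg g0 m'E m'T f mf f1.
have ig : m.-integrable setT (EFin \o g).
  apply/integrableP; split; first exact/measurable_EFinP.
  by under eq_integral do rewrite /= ger0_norm//; rewrite -m'E.
have if' : m'.-integrable setT (EFin \o f) by exact: bounded_integrable f1.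
have ifg : m.-integrable setT (EFin \o (fun x => f x * g x)).
  apply: (dominated_integrable _ ig); first exact: measurable_funM.
  by move=> x; rewrite normrM (ger0_norm (g0 x)) ler_piMl.
have i1 : m'.-integrable setT (EFin \o cst (1 : R)).
  by apply: (@bounded_integrable _ _ _ _ 1) => // x; rewrite normr1.
have h1 : \int[m']_x 1 = \int[m]_x g x.
  rewrite /Rintegral (integral_density mg g0 m'E)//.
  by congr fine; apply: eq_integral => x _; rewrite mul1r.
have h2 : \int[m']_x (f x + 1) = \int[m]_x (f x * g x + g x).
  rewrite /Rintegral (integral_density mg g0 m'E)//.
  - by congr fine; apply: eq_integral => x _; rewrite mulrDl mul1r.
  - exact: measurable_funD.
  - by move=> x; rewrite -lerBlDr sub0r; have := f1 x; rewrite ler_norml => /andP[].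
by move: h2; rewrite RintegralD// RintegralD// -h1 => /addIr.
Qed.

(** The image measure is given by its values on sets, so the case [m1 = m2] expresses the invariance
    of a measure under [phi]. *)
Lemma Rintegral_pushforward d1 d2 (T1 : measurableType d1) (T2 : measurableType d2)
    (m1 : {measure set T1 -> \bar R}) (m2 : {measure set T2 -> \bar R})
    (phi : T1 -> T2) (f : T2 -> R) :
  measurable_fun setT phi -> (forall A, measurable A -> m2 A = m1 (phi @^-1` A)) ->
  measurable_fun setT f -> m1.-integrable setT (EFin \o (f \o phi)) ->
  \int[m2]_x f x = \int[m1]_x f (phi x).
Proof.
move=> mphi m12 mf intf; rewrite /Rintegral; congr fine.
pose phi' : {mfun T1 >-> T2} := HB.pack phi (isMeasurableFun.Build _ _ _ _ _ mphi).
transitivity (\int[pushforward m1 phi']_x (f x)%:E)%E.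
  by apply: eq_measure_integral => A mA _; rewrite m12.
by rewrite integral_pushforward ?preimage_setT//; exact/measurable_EFinP.
Qed.

Lemma integrable_comp d1 d2 (T1 : measurableType d1) (T2 : measurableType d2)
    (m1 : {measure set T1 -> \bar R}) (m2 : {measure set T2 -> \bar R})
    (phi : T1 -> T2) (f : T2 -> R) :
  measurable_fun setT phi -> (forall A, measurable A -> m2 A = m1 (phi @^-1` A)) ->
  m2.-integrable setT (EFin \o f) -> m1.-integrable setT (EFin \o (f \o phi)).
Proof.
move=> mphi m12 /integrableP[mf foo]; apply/integrableP; split.
  exact: (measurableT_comp mf).
pose phi' : {mfun T1 >-> T2} := HB.pack phi (isMeasurableFun.Build _ _ _ _ _ mphi).
apply: le_lt_trans foo.
rewrite (eq_measure_integral (pushforward m1 phi')); last by move=> A mA _; rewrite m12.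
rewrite [leRHS]ge0_integral_pushforward ?preimage_setT//.
by apply: measurableT_comp.
Qed.

Lemma Rintegral_odd d (T : measurableType d) (m : {measure set T -> \bar R})
    (phi : T -> T) (f : T -> R) :
  measurable_fun setT phi -> (forall A, measurable A -> m A = m (phi @^-1` A)) ->
  (forall x, f (phi x) = - f x) -> m.-integrable setT (EFin \o f) ->
  \int[m]_x f x = 0.
Proof.
move=> mphi mm fN intf.
have mf : measurable_fun setT f by exact/measurable_EFinP/(measurable_int _ intf).
have intN : m.-integrable setT (EFin \o (f \o phi)).
  rewrite (_ : EFin \o _ = -%E \o (EFin \o f))%E; first exact: integrableN.
  by apply/funext => x /=; rewrite fN.
have : \int[m]_x f x = - \int[m]_x f x.
  rewrite -mulN1r -RintegralZl// {1}(Rintegral_pushforward mphi mm mf intN).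
  by apply: eq_Rintegral => x _; rewrite fN mulN1r.
move: (\int[m]_x f x) => I; lra.
Qed.

(** In all applications the first variable enters through bounded functions, so a dominating
    function of the second variable alone, with [m1] finite, gives joint integrability. *)
Lemma Fubini_dominated d1 d2 (T1 : measurableType d1) (T2 : measurableType d2)
    (m1 : {finite_measure set T1 -> \bar R}) (m2 : {finite_measure set T2 -> \bar R})
    (f : T1 * T2 -> R) (g : T2 -> R) : measurable_fun setT f ->
  m2.-integrable setT (EFin \o g) -> (forall x y, `|f (x, y)| <= g y) ->
  [/\ forall y, m1.-integrable setT (fun x => (f (x, y))%:E),
      forall x, m2.-integrable setT (fun y => (f (x, y))%:E),
      measurable_fun setT (fun x => \int[m2]_y f (x, y)),
      m2.-integrable setT (EFin \o (fun y => \int[m1]_x f (x, y)))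
    & \int[m1]_x \int[m2]_y f (x, y) = \int[m2]_y \int[m1]_x f (x, y)
      /\ \int[m1]_x \int[m2]_y f (x, y) = \int[(m1 \x m2)%E]_z f z].
Proof.
move=> mf ig fg.
have i1 y : m1.-integrable setT (fun x => (f (x, y))%:E).
  apply: (@bounded_integrable _ _ m1 _ (g y)) => //.
    by rewrite ltey_eq fin_num_measure.
  exact: (measurableT_comp mf).
have i2 x : m2.-integrable setT (fun y => (f (x, y))%:E).
  apply: (dominated_integrable _ ig) => //.
  exact: (measurableT_comp mf).
(* The bound at the default point of [T1] already forces nonnegativity. *)
have g0 y : 0 <= g y by apply: le_trans (fg point y).
have i12 : (m1 \x m2)%E.-integrable setT (EFin \o f).
  apply/integrable12ltyP; first exact/measurable_EFinP.
  apply: (@le_lt_trans _ _ (\int[m1]_x (\int[m2]_y (g y)%:E))%E).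
    apply: ge0_le_integral => //.
    - by move=> x _; exact: integral_ge0.
    - apply: (measurable_fun_fubini_tonelli_F (fun z => `|(EFin \o f) z|%E)) => //.
      by apply: measurableT_comp => //; exact/measurable_EFinP.
    - move=> x _; apply: ge0_le_integral => //.
      + by apply: measurableT_comp => //; exact: (measurable_int _ (i2 x)).
      + by move/measurable_int : ig.
      + by move=> y _; rewrite /= lee_fin.
  rewrite integral_cst// lte_mul_pinfty//; last by rewrite ltey_eq fin_num_measure.
    by apply: integral_ge0 => y _; rewrite lee_fin.
  exact: integrable_fin_num.
have e1 x : (\int[m2]_y f (x, y))%:E = (\int[m2]_y (f (x, y))%:E)%E.
  by rewrite fineK//; exact: integrable_fin_num.
have e2 y : (\int[m1]_x f (x, y))%:E = (\int[m1]_x (f (x, y))%:E)%E.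
  by rewrite fineK//; exact: integrable_fin_num.
split => //.
- apply/measurable_EFinP; rewrite (_ : _ \o _ = fun x => \int[m2]_y (f (x, y))%:E)%E.
    exact: (measurable_fubini_F i12).
  by apply/funext => x; exact: e1.
- rewrite (_ : _ \o _ = fun y => \int[m1]_x (f (x, y))%:E)%E; last first.
    by apply/funext => y; exact: e2.
  apply/integrableP; split; first exact: (measurable_fubini_G i12).
  apply: (@le_lt_trans _ _ (\int[m2]_y (fine (m1 setT) * g y)%:E)%E); last first.
    under eq_integral do rewrite EFinM.
    apply: integrable_lty => //; exact: integrableZl.
  apply: ge0_le_integral => //.
  + by apply: measurableT_comp => //; exact: (measurable_fubini_G i12).
  + by apply/measurable_EFinP/measurable_funM => //; move/measurable_int : ig => /measurable_EFinP.
  + move=> y _; rewrite -e2 lee_fin (le_trans (le_normr_Rintegral _ (i1 y)))//.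
    rewrite mulrC -Rintegral_cst//; apply: le_Rintegral => //.
      exact: (@integrable_norm _ _ _ m1 _ (fun x => f (x, y)) (i1 y)).
    exact: finite_measure_integrable_cst.
have h1 : \int[m1]_x \int[m2]_y f (x, y) =
    fine (\int[m1]_x \int[m2]_y (f (x, y))%:E)%E.
  by congr fine; apply: eq_integral => x _; exact: e1.
rewrite h1; split; last by congr fine; exact: (integral12_prod_meas1 i12).
rewrite (Fubini i12); congr fine.
by apply: eq_integral => y _; apply/esym; exact: e2.
Qed.

End measure_tools.

Section ge0_real_integral.
Context d (T : measurableType d) (R : realType) (m : {measure set T -> \bar R}).
Variables (D : set T) (mD : measurable D).

Lemma ge0_integral_mulrl (g : T -> R) c : measurable_fun setT g ->
  (forall x, 0 <= g x) -> 0 <= c ->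
  (\int[m]_(x in D) (c * g x)%:E = c%:E * \int[m]_(x in D) (g x)%:E)%E.
Proof.
move=> mg g0 c0; under eq_integral do rewrite EFinM.
apply: ge0_integralZl => //; first exact/measurable_funTS/measurable_EFinP.
by move=> x _; rewrite lee_fin.
Qed.

Lemma ge0_le_integral_EFin (f g : T -> R) : measurable_fun setT f -> measurable_fun setT g ->
  (forall x, 0 <= f x) -> (forall x, D x -> f x <= g x) ->
  (\int[m]_(x in D) (f x)%:E <= \int[m]_(x in D) (g x)%:E)%E.
Proof.
move=> mf mg f0 fg; apply: ge0_le_integral => //.
- by move=> x _; rewrite lee_fin.
- exact/measurable_funTS/measurable_EFinP.
- exact/measurable_funTS/measurable_EFinP.
Qed.

End ge0_real_integral.

(** * The characteristic function of the normal law *)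

Section gaussian_cos.
Context (R : realType) (s : R) (s_gt0 : 0 < s).
Notation mu := (@lebesgue_measure R).
Let g : R -> R := normal_pdf 0 s.

Let s_neq0 : s != 0. Proof. by rewrite gt_eqF. Qed.

Let gE y : g y = normal_peak s * expR (- y ^+ 2 / (s ^+ 2 *+ 2)).
Proof. by rewrite /g normal_pdfE// /normal_fun subr0. Qed.

Let ig : mu.-integrable setT (EFin \o g).
Proof. exact: integrable_normal_pdf. Qed.

Let mg : measurable_fun setT g. Proof. exact: measurable_normal_pdf. Qed.

Let cg : continuous g. Proof. exact: continuous_normal_pdf. Qed.

Let g_ge0 y : 0 <= g y. Proof. exact: normal_pdf_ge0. Qed.

Let derg (y : R) : is_derive y (1 : R) g (- (y / s ^+ 2) * g y).
Proof.
have -> : g = normal_peak s \*: (expR \o ((- (s ^+ 2 *+ 2)^-1) \*: (fun z : R => z ^+ 2))).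
  by apply/funext => z /=; rewrite gE /GRing.scale/= !mulNr (mulrC (z ^+ 2)).
apply: is_derive_eq.
rewrite /GRing.scale/=.
move: (expR _) (normal_peak s) => e q; rewrite -mulr_natl.
by rewrite -[q *: e]/(q * e); field.
Qed.

Let iyg : mu.-integrable setT (EFin \o (fun y => `|y| * g y)).
Proof.
(* The density of deviation 2s decays like e^{-z} with z = y^2 / (8 s^2), while g decays like
   e^{-4z}. The spare e^{-3z} absorbs |y|, since |y| <= 1 + y^2 = 1 + 8 s^2 z <= (1 + 8 s^2)
   e^{3z}. *)
pose c := (1 + 8 * s ^+ 2) * normal_peak s / normal_peak (2 * s).
have s2 : 2 * s != 0 by rewrite mulf_neq0.
apply: (@dominated_integrable _ _ _ mu _ (fun y => c * normal_pdf 0 (2 * s) y)).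
- by apply: measurable_funM => //; exact: measurableT_comp.
- rewrite (_ : _ \o _ = fun y => c%:E * (normal_pdf 0 (2 * s) y)%:E)%E.
    by apply: integrableZl => //; exact: integrable_normal_pdf.
  by apply/funext => y.
move=> y; rewrite ger0_norm ?mulr_ge0// gE normal_pdfE// /normal_fun subr0.
have -> : c * (normal_peak (2 * s) * expR (- y ^+ 2 / ((2 * s) ^+ 2 *+ 2))) =
    (1 + 8 * s ^+ 2) * expR (- y ^+ 2 / ((2 * s) ^+ 2 *+ 2)) * normal_peak s.
  by rewrite /c; field; rewrite gt_eqF// normal_peak_gt0.
rewrite mulrCA mulrC ler_wpM2r ?normal_peak_ge0//.
pose z := y ^+ 2 / (8 * s ^+ 2).
have z0 : 0 <= z by rewrite divr_ge0 ?sqr_ge0// mulr_ge0// sqr_ge0.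
have -> : - y ^+ 2 / (s ^+ 2 *+ 2) = - z - 3 * z.
  by rewrite /z -mulr_natl; field.
have -> : - y ^+ 2 / ((2 * s) ^+ 2 *+ 2) = - z by rewrite /z -mulr_natl; field.
rewrite expRD mulrCA -[leRHS]mulrC ler_wpM2l ?expR_ge0//.
have y1 : `|y| <= 1 + y ^+ 2.
  by rewrite -real_normK ?num_real//; have := sqr_ge0 (`|y| - 1); move: `|y| => r; nra.
rewrite expRN ler_pdivrMr ?expR_gt0//.
have e3 : 1 + 3 * z <= expR (3 * z) by exact: expR_ge1Dx.
have yz : y ^+ 2 = 8 * s ^+ 2 * z by rewrite /z; field.
rewrite yz in y1; have := sqr_ge0 s; nra.
Qed.

Let mcos (x : R) : measurable_fun [set: R] (fun y : R => cos (y * x)).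
Proof.
apply: measurableT_comp; first by apply: continuous_measurable_fun; exact: continuous_cos.
exact: measurable_funM.
Qed.

Let msin (x : R) : measurable_fun [set: R] (fun y : R => sin (y * x)).
Proof.
apply: measurableT_comp; first by apply: continuous_measurable_fun; exact: continuous_sin.
exact: measurable_funM.
Qed.

Let igcos (x : R) : mu.-integrable setT (EFin \o (fun y => g y * cos (y * x))).
Proof.
apply: (dominated_integrable _ ig).
  by apply: measurable_funM; [exact: mg|exact: mcos].
by move=> y; rewrite normrM (ger0_norm (g_ge0 y)) ler_piMr// cos_max.
Qed.

Let igsin (x : R) : mu.-integrable setT (EFin \o (fun y => g y * sin (y * x))).
Proof.
apply: (dominated_integrable _ ig).
  by apply: measurable_funM; [exact: mg|exact: msin].
by move=> y; rewrite normrM (ger0_norm (g_ge0 y)) ler_piMr// sin_max.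
Qed.

Let iygsin (x : R) : mu.-integrable setT (EFin \o (fun y => y * g y * sin (y * x))).
Proof.
apply: (dominated_integrable _ iyg).
  apply: measurable_funM; last exact: msin.
  apply: measurable_funM; last exact: mg.
  exact: measurable_id.
by move=> y; rewrite 2!normrM (ger0_norm (g_ge0 y)) ler_piMr ?mulr_ge0// sin_max.
Qed.

(** Integration by parts based on g' = - (y / s^2) g: [h] is the derivative of [H], whose boundary
    values vanish at infinity, so [h] has integral 0. *)
Let sin_by_parts x : s ^+ 2 * x * \int[mu]_y (g y * cos (y * x)) =
  \int[mu]_y (y * g y * sin (y * x)).
Proof.
pose H (y : R) := s ^+ 2 * g y * sin (y * x).
pose h (y : R) := s ^+ 2 * x * (g y * cos (y * x)) - y * g y * sin (y * x).
have dH (y : R) : is_derive y (1 : R) H (h y).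
  have d1 := derg y.
  have d2 : is_derive y (1 : R) (fun y : R => sin (y * x)) (cos (y * x) * x).
    rewrite (_ : (fun y : R => _) = sin \o (x \*: id)).
      by apply: is_derive_eq; rewrite /GRing.scale/= mulr1 -[x *: y]/(x * y) (mulrC x).
    by apply/funext => z; rewrite /GRing.scale/= mulrC.
  rewrite (_ : H = (s ^+ 2 \*: g) * (fun y : R => sin (y * x))); last exact/funext.
  apply: is_derive_eq; rewrite /h /GRing.scale/=.
  rewrite -[s ^+ 2 *: g y]/(s ^+ 2 * g y).
  by field.
have ih : mu.-integrable setT (EFin \o h).
  rewrite (_ : _ \o _ = (fun y => (s ^+ 2 * x)%:E * (g y * cos (y * x))%:E -
      (y * g y * sin (y * x))%:E)%E); last by apply/funext.
  by apply: integrableB => //; [apply: integrableZl => //; exact: igcos|exact: iygsin].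
have ch : continuous h.
  move=> y; apply: cvgB.
    apply: cvgM; first exact: cvg_cst.
    apply: cvgM; first exact: cg.
    apply: continuous_comp; last exact: continuous_cos.
    by apply: cvgM; [exact: cvg_id|exact: cvg_cst].
  apply: cvgM; first by apply: cvgM; [exact: cvg_id|exact: cg].
  apply: continuous_comp; last exact: continuous_sin.
  by apply: cvgM; [exact: cvg_id|exact: cvg_cst].
suff : \int[mu]_y h y = 0.
  rewrite RintegralB//; last first.
    rewrite (_ : _ \o _ = (fun y => (s ^+ 2 * x)%:E * (g y * cos (y * x))%:E)%E);
      last by apply/funext.
    by apply: integrableZl => //; exact: igcos.
  by rewrite RintegralZl//; move=> /eqP; rewrite subr_eq0 => /eqP.
have FTC n : (\int[mu]_(y in `[(- n.+1%:R)%R, n.+1%:R]) (h y)%:E)%E =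
    (s ^+ 2 * (2 * (g n.+1%:R * sin (n.+1%:R * x))))%:E.
  rewrite (@continuous_FTC2 _ h H).
  - rewrite -EFinB /H; congr EFin.
    have -> : g (- n.+1%:R) = g n.+1%:R by rewrite !gE sqrrN.
    by rewrite mulNr sinN; field.
  - by rewrite (@lt_trans _ _ 0) ?ltr0Sn// oppr_lt0.
  - exact: continuous_subspaceT.
  - split => [y _||].
    + by have [] := dH y.
    + apply: cvg_at_right_filter.
      by have [/derivable1_diffP/differentiable_continuous] := dH (- n.+1%:R).
    + apply: cvg_at_left_filter.
      by have [/derivable1_diffP/differentiable_continuous] := dH (n.+1%:R).
  - by move=> y _; rewrite derive1E; have [] := dH y.
have gn0 : (fun n : nat => s ^+ 2 * (2 * (g n.+1%:R * sin (n.+1%:R * x)))) @ \oo --> 0.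
  (* From e^{-u} <= 1 / u with u = n^2 / (2 s^2), followed by n^2 >= n. *)
  pose c := s ^+ 2 * (2 * (normal_peak s * (s ^+ 2 *+ 2))).
  have c0 : 0 <= c by rewrite !mulr_ge0 ?normal_peak_ge0 ?(ltW s_gt0)// mulrn_wge0 ?sqr_ge0.
  apply/norm_cvg0P; apply: (@squeeze_cvgr _ _ _ _ (cst 0) (fun n : nat => c * n.+1%:R^-1)).
  - near=> n; rewrite normr_ge0/= normrM (ger0_norm (sqr_ge0 s)) /c -!mulrA.
    do 2 rewrite ler_wpM2l ?(ltW s_gt0)//.
    rewrite normrM (ger0_norm (_ : 0 <= 2))// ler_wpM2l//.
    rewrite normrM (ger0_norm (g_ge0 _)) (@le_trans _ _ (g n.+1%:R))//.
      by rewrite ler_piMr// sin_max.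
    rewrite gE ler_wpM2l ?normal_peak_ge0//.
    rewrite mulNr expRN -[leRHS]invrK lef_pV2 ?posrE ?expR_gt0//; last first.
      by rewrite invr_gt0 mulr_gt0// ?pmulrn_lgt0 ?exprn_gt0.
    apply: le_trans (expR_ge1Dx _).
    rewrite invfM invrK -[leLHS]add0r lerD// mulrC ler_pM2r ?invr_gt0 ?pmulrn_lgt0 ?exprn_gt0//.
    by rewrite expr2 ler_peMr// ler1n.
  - exact: cvg_cst.
  - rewrite -(mulr0 c); apply: cvgM; first exact: cvg_cst.
    exact: cvg_harmonic.
have D : (\int[mu]_y ((h \_ `[(- n.+1%:R)%R, n.+1%:R]) y)%:E @[n --> \oo] -->
    \int[mu]_y (h y)%:E)%E.
  apply: (@dominated_cvg _ _ _ mu setT measurableT _ _ (fun y => `|h y|%:E)).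
  - move=> n; apply/measurable_EFinP.
    apply: (measurable_restrictT _ _).1 => //.
    by apply: measurable_funTS; exact: continuous_measurable_fun.
  - move=> y _; apply: cvg_near_cst; near=> n; rewrite patchE ifT// inE/= in_itv/= -ler_norml.
    near: n; exists (Num.truncn `|y|)%N => // n /= yn.
    by rewrite ltW// (lt_le_trans (truncnS_gt _))// ler_nat.
  - by [].
  - exact: (integrable_norm ih).
  - by move=> n y _; rewrite patchE /= lee_fin; case: ifP => // _; rewrite normr0.
rewrite /Rintegral -[RHS]/(fine 0%E); congr fine.
apply: (cvg_unique _ D) => //.
rewrite (_ : (fun _ => _) =
    EFin \o (fun n : nat => s ^+ 2 * (2 * (g n.+1%:R * sin (n.+1%:R * x))))).
  by apply: cvg_EFin; [exact: nearW|exact: gn0].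
apply/funext => n /=; rewrite -FTC [RHS]integral_mkcond.
by apply: eq_integral => y _; rewrite restrict_EFin.
Unshelve. all: by end_near. Qed.

Let F (x : R) := \int[mu]_y (g y * cos (y * x)).

Let derF (x : R) : is_derive x (1 : R) F (- (s ^+ 2 * x) * F x).
Proof.
pose f (z y : R) := g y * cos (y * z).
have df (z y : R) : is_derive z (1 : R) (f ^~ y) (- (y * g y * sin (y * z))).
  rewrite (_ : f ^~ y = g y \*: (cos \o (y \*: id))); last exact/funext.
  apply: is_derive_eq; rewrite /GRing.scale/= mulr1 -[y *: z]/(y * z).
  by ring.
(* The bound [ub] is uniform in the parameter, so any interval around [x] would do. *)
have Ix : x \in `](x - 1), (x + 1)[ by rewrite in_itv/=; apply/andP; split; lra.
have D1 (w y : R) : partial1of2 f w y = - (y * g y * sin (y * w)).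
  by rewrite /partial1of2 derive1E; have [] := df w y.
have der1 (w y : R) : derivable (f ^~ y) w 1 by have [] := df w y.
have ub (w y : R) : `|partial1of2 f w y| <= `|y| * g y.
  rewrite D1 normrN 2!normrM (ger0_norm (g_ge0 y)).
  by rewrite ler_piMr ?mulr_ge0// sin_max.
have yg_ge0 (y : R) : 0 <= `|y| * g y by rewrite mulr_ge0.
have dF := @derivable_under_integral _ _ _ mu f setT measurableT x _ _ Ix
  (fun z _ => igcos z) (fun z y _ _ => der1 z y) _ yg_ge0 iyg (fun z y _ _ => ub z y).
have eF := @differentiation_under_integral _ _ _ mu f setT measurableT x _ _ Ix
  (fun z _ => igcos z) (fun z y _ _ => der1 z y) _ yg_ge0 iyg (fun z y _ _ => ub z y).
apply: DeriveDef; first exact: dF.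
rewrite -derive1E eF mulNr sin_by_parts -mulN1r -RintegralZl//.
by apply: eq_Rintegral => y _; rewrite D1 mulN1r.
Qed.

(** By [derF], F solves F' = - s^2 x F, so F(x) e^{s^2 x^2 / 2} has zero derivative and keeps its
    value 1 at the origin. *)
Let FE (x : R) : F x = expR (- s ^+ 2 * x ^+ 2 / 2).
Proof.
pose E := F * (expR \o ((s ^+ 2 / 2) \*: (fun z : R => z ^+ 2))).
have dE (y : R) : is_derive y (1 : R) E 0.
  have d1 := derF y.
  apply: is_derive_eq; rewrite /GRing.scale/=.
  rewrite -[_ *: y ^+ 2]/(s ^+ 2 / 2 * y ^+ 2).
  by field.
have : E x = E 0 by exact: is_derive_0_is_cst.
rewrite /E /= !fctE /= [in RHS]expr0n/= /GRing.scale/= mulr0 expR0 mulr1.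
have -> : F 0 = 1.
  rewrite /F /Rintegral; under eq_integral do rewrite mulr0 cos0 mulr1.
  by rewrite integral_normal_pdf.
move=> h; have {}h : F x * expR (s ^+ 2 / 2 * x ^+ 2) = 1 by exact: h.
apply: (mulIf (lt0r_neq0 (expR_gt0 (s ^+ 2 / 2 * x ^+ 2)))).
by rewrite h -expRD [X in expR X](_ : _ = 0) ?expR0//; field.
Qed.

Let normalE (f : R -> R) : measurable_fun [set: R] f -> (forall y, `|f y| <= 1) ->
  \int[normal_prob 0 s]_y f y = \int[mu]_y (g y * f y).
Proof.
move=> mf f1.
have mT : (normal_prob 0 s setT < +oo)%E by rewrite probability_setT ltry.
have mE A : measurable A -> normal_prob 0 s A = (\int[mu]_(x in A) (g x)%:E)%E by [].
rewrite (@Rintegral_density R _ (measurableTypeR R) mu (normal_prob 0 s) g mg g_ge0 mE mT f mf f1).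
by apply: eq_Rintegral => y _; rewrite mulrC.
Qed.

Lemma normal_cos x : \int[normal_prob 0 s]_y cos (y * x) = expR (- s ^+ 2 * x ^+ 2 / 2).
Proof. by rewrite normalE//; [exact: FE|move=> y; exact: cos_max]. Qed.

Lemma normal_sin x : \int[normal_prob 0 s]_y sin (y * x) = 0.
Proof.
rewrite normalE//; last by move=> y; exact: sin_max.
apply: (@Rintegral_odd _ _ _ mu (-%R)) => //.
- by move=> A mA; rewrite -[LHS]lebesgue_measureN.
- by move=> y; rewrite mulNr sinN mulrN !gE sqrrN.
Qed.

End gaussian_cos.

(** * Scalar product on R^d: algebra and measurability *)

Section dotp_theory.
Context (R : realType).

Lemma dotpC d (x y : 'rV[R]_d) : dotp x y = dotp y x.
Proof. by apply: eq_bigr => i _; rewrite mulrC. Qed.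

Lemma dotpDr d (x y z : 'rV[R]_d) : dotp x (y + z) = dotp x y + dotp x z.
Proof. by rewrite -big_split; apply: eq_bigr => i _; rewrite mxE mulrDr. Qed.

Lemma dotpZr d (x y : 'rV[R]_d) a : dotp x (a *: y) = a * dotp x y.
Proof. by rewrite mulr_sumr; apply: eq_bigr => i _; rewrite mxE mulrCA. Qed.

Lemma dotpNr d (x y : 'rV[R]_d) : dotp x (- y) = - dotp x y.
Proof. by rewrite -scaleN1r dotpZr mulN1r. Qed.

Lemma dotpBr d (x y z : 'rV[R]_d) : dotp x (y - z) = dotp x y - dotp x z.
Proof. by rewrite dotpDr dotpNr. Qed.

Lemma dotpBl d (x y z : 'rV[R]_d) : dotp (y - z) x = dotp y x - dotp z x.
Proof. by rewrite dotpC dotpBr !(dotpC x). Qed.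

Lemma dotp_ge0 d (x : 'rV[R]_d) : 0 <= dotp x x.
Proof. by apply: sumr_ge0 => i _; rewrite -expr2 sqr_ge0. Qed.

Lemma measurable_dotp d d0 (T : measurableType d0) (f g : T -> 'rV[R]_d) :
  measurable_fun setT f -> measurable_fun setT g ->
  measurable_fun setT (fun t => dotp (f t) (g t)).
Proof.
move=> mf mg.
have mc (h : T -> 'rV[R]_d) i : measurable_fun setT h ->
  measurable_fun setT (fun t => h t 0 i).
  by move=> mh; exact: (measurableT_comp (measurable_coord_rV i)).
by apply: measurable_sum => i; apply: measurable_funM; exact: mc.
Qed.

Lemma measurable_oppr_rV d : measurable_fun setT (-%R : 'rV[R]_d -> 'rV[R]_d).
Proof.
apply: measurable_fun_rV => i; under eq_fun do rewrite mxE.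
by apply: measurableT_comp => //; exact: measurable_coord_rV.
Qed.

Lemma measurable_cos d0 (T : measurableType d0) (f : T -> R) :
  measurable_fun setT f -> measurable_fun setT (fun t => cos (f t)).
Proof.
move=> mf; apply: measurableT_comp => //.
by apply: continuous_measurable_fun; exact: continuous_cos.
Qed.

Lemma measurable_sin d0 (T : measurableType d0) (f : T -> R) :
  measurable_fun setT f -> measurable_fun setT (fun t => sin (f t)).
Proof.
move=> mf; apply: measurableT_comp => //.
by apply: continuous_measurable_fun; exact: continuous_sin.
Qed.

End dotp_theory.

(** Only the characteristic function of the law is ever used, so the law is specified by it, real
    and imaginary parts apart; [s] is the standard deviation of each coordinate. *)
Definition centered_gaussian (R : realType) d (s : R) (M : probability 'rV[R]_d R) : Prop :=
  forall x, \int[M]_v cos (dotp v x) = expR (- s ^+ 2 * dotp x x / 2) /\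
    \int[M]_v sin (dotp v x) = 0.

(** * Existence of the isotropic normal law on R^d *)

Section gaussian_rV.
Context (R : realType) (s : R) (s_gt0 : 0 < s).

Lemma Rintegral_prob_cst d (T : measurableType d) (P : probability T R) (c : R) :
  \int[P]_x c = c.
Proof. by rewrite Rintegral_cst// [X in fine X](probability_setT P) mulr1. Qed.

Lemma finite_bounded_integrable d (T : measurableType d) (m : {finite_measure set T -> \bar R})
    (f : T -> R) c : measurable_fun setT f -> (forall x, `|f x| <= c) ->
  m.-integrable setT (EFin \o f).
Proof. by move=> mf fc; apply: bounded_integrable fc => //; rewrite ltey_eq fin_num_measure. Qed.

(** Induction on the dimension: an independent normal coordinate is put in front. The characteristic
    function factors by the addition formulas, whose sine terms integrate to 0. *)
Lemma gaussian_rV d : exists M : probability 'rV[R]_d R, centered_gaussian s M.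
Proof.
elim: d => [|d [M hM]].
  exists (\d_(0 : 'rV[R]_0) : probability _ R) => x.
  have d0 (v w : 'rV[R]_0) : dotp v w = 0 by rewrite /dotp big_ord0.
  under eq_Rintegral do rewrite d0 cos0.
  under [X in _ /\ X = _]eq_Rintegral do rewrite d0 sin0.
  by rewrite !Rintegral_prob_cst d0 mulr0 mul0r expR0.
pose P : probability (measurableTypeR R) R := normal_prob 0 s.
pose cons' : {mfun (measurableTypeR R * 'rV[R]_d)%type >-> 'rV[R]_d.+1} :=
  HB.pack (@cons_rV R d) (isMeasurableFun.Build _ _ _ _ _ (@measurable_cons_rV R d)).
pose PM : probability (measurableTypeR R * 'rV[R]_d)%type R := (P \x M)%E.
exists (distribution PM cons') => x.
set x0 := x 0 ord0; set x' := (uncons_rV x).2.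
have dE a v : dotp (cons_rV (a, v)) x = a * x0 + dotp v x'.
  rewrite /dotp big_ord_recl mxE unlift_none; congr (_ + _).
  by apply: eq_bigr => i _; rewrite !mxE liftK.
have -> : dotp x x = x0 ^+ 2 + dotp x' x'.
  rewrite -[x in dotp x _](_ : cons_rV (x0, x') = x) ?dE ?expr2 ?dotpC//.
    by apply/rowP => i; rewrite !mxE; case: unliftP => [j ->|->]//; rewrite mxE.
pose c := expR (- s ^+ 2 * x0 ^+ 2 / 2); pose c' := expR (- s ^+ 2 * dotp x' x' / 2).
have mP a : measurable_fun setT (fun v : 'rV[R]_d => a * x0 + dotp v x').
  by apply: measurable_funD => //; exact: measurable_dotp.
have mPM : measurable_fun setT
    (fun z : (measurableTypeR R * 'rV[R]_d)%type => z.1 * x0 + dotp z.2 x').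
  apply: measurable_funD; first by apply: measurable_funM => //; exact: measurable_fst.
  by apply: measurable_dotp => //; exact: measurable_snd.
have mx : measurable_fun setT (fun v : 'rV[R]_d.+1 => dotp v x).
  exact: measurable_dotp.
have i1 := finite_bounded_integrable.
(* Stated for a general bounded [f] so as to serve both cosine and sine. *)
have push (f : R -> R) : measurable_fun setT f -> (forall u, `|f u| <= 1) ->
    \int[distribution PM cons']_v f (dotp v x) =
    \int[P]_a \int[M]_v f (a * x0 + dotp v x').
  move=> mf f1.
  rewrite (@Rintegral_pushforward _ _ _ _ _ PM _ (@cons_rV R d))//; first last.
  - apply: (i1 _ _ PM _ 1) => [|z]; last exact: f1.
    apply: (measurableT_comp mf).
    exact: (measurableT_comp mx (@measurable_cons_rV R d)).
  - exact: (measurableT_comp mf).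
  - exact: measurable_cons_rV.
  have [] := @Fubini_dominated R _ _ _ _ P M
    (fun z => f (z.1 * x0 + dotp z.2 x')) (cst 1).
  - exact: (measurableT_comp mf).
  - by apply: (i1 _ _ M _ 1) => // y; rewrite normr1.
  - by move=> a v; exact: f1.
  move=> _ _ _ _ [_ ->]; apply: eq_Rintegral => -[a v] _.
  by rewrite dE.
have iMc : M.-integrable setT (EFin \o (fun v => cos (dotp v x'))).
  by apply: (i1 _ _ M _ 1) => [|v]; [apply: measurable_cos; exact: measurable_dotp|exact: cos_max].
have iMs : M.-integrable setT (EFin \o (fun v => sin (dotp v x'))).
  by apply: (i1 _ _ M _ 1) => [|v]; [apply: measurable_sin; exact: measurable_dotp|exact: sin_max].
have [hc hs] := hM x'.
have mx0 : measurable_fun setT (fun a : measurableTypeR R => a * x0).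
  exact: measurable_funM.
have iP (f : measurableTypeR R -> R) : measurable_fun setT f -> (forall u, `|f u| <= 1) ->
    P.-integrable setT (EFin \o f).
  by move=> mf f1; exact: (i1 _ _ P _ 1).
have mcos : measurable_fun setT (@cos R).
  by apply: continuous_measurable_fun; exact: continuous_cos.
have msin : measurable_fun setT (@sin R).
  by apply: continuous_measurable_fun; exact: continuous_sin.
split.
  rewrite (push cos mcos (@cos_max R)).
  transitivity (\int[P]_a (cos (a * x0) * c')).
    apply: eq_Rintegral => a _; under eq_Rintegral do rewrite cosD.
    rewrite RintegralB//; [|exact: integrable_mulrl|exact: integrable_mulrl].
    by rewrite !RintegralZl// hc hs mulr0 subr0.
  rewrite RintegralZr//; last by apply: iP => [|u]; [exact: measurable_cos|exact: cos_max].
  by rewrite normal_cos// -expRD -mulrDl -mulrDr.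
rewrite (push sin msin (@sin_max R)).
transitivity (\int[P]_a (sin (a * x0) * c')).
  apply: eq_Rintegral => a _; under eq_Rintegral do rewrite sinD.
  rewrite RintegralD//; [|exact: integrable_mulrl|exact: integrable_mulrl].
  by rewrite !RintegralZl// hc hs mulr0 addr0.
rewrite RintegralZr//; last by apply: iP => [|u]; [exact: measurable_sin|exact: sin_max].
by rewrite normal_sin// mul0r.
Qed.

End gaussian_rV.

(** * Tilting a finite measure *)

Section shift_operator.
Context (R : realType) (d : nat).
Variables (lam : {finite_measure set 'rV[R]_d -> \bar R}) (M : probability 'rV[R]_d R).
Variables (h : 'rV[R]_d -> R) (h_ge0 : forall y, 0 <= h y)
  (ih : lam.-integrable setT (EFin \o h)).

(* With h y = e^(xi0.y) these are the real and imaginary parts of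
   int (e^(xi0.y) e^(i xi.y) - 1) dlam(y); h = 1 gives the exponent of lam itself. *)
Definition tilt_re xi := \int[lam]_y (h y * cos (dotp xi y) - 1).
Definition tilt_im xi := \int[lam]_y (h y * sin (dotp xi y)).
Definition tilt_bound := \int[lam]_y (h y + 1).

Let ih1 : lam.-integrable setT (EFin \o (fun y => h y + 1)).
Proof.
apply: integrable_addr => //; exact: (@finite_measure_integrable_cst _ _ _ lam setT 1).
Qed.

Let mh : measurable_fun setT h.
Proof. by move/measurable_int : ih => /measurable_EFinP. Qed.

Let mdot : measurable_fun setT (fun z : ('rV[R]_d * 'rV[R]_d)%type => dotp z.1 z.2).
Proof. by apply: measurable_dotp; [exact: measurable_fst|exact: measurable_snd]. Qed.

Let mh2 : measurable_fun setT (fun z : ('rV[R]_d * 'rV[R]_d)%type => h z.2).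
Proof. by apply: (measurableT_comp mh); exact: measurable_snd. Qed.

Let re_bound xi y : `|h y * cos (dotp xi y) - 1| <= h y + 1.
Proof.
rewrite (le_trans (ler_normB _ _))// normr1 lerD// normrM (ger0_norm (h_ge0 y)).
by rewrite ler_piMr// cos_max.
Qed.

Let im_bound xi y : `|h y * sin (dotp xi y)| <= h y + 1.
Proof.
rewrite ler_wpDr// normrM (ger0_norm (h_ge0 y)).
by rewrite ler_piMr// sin_max.
Qed.

Let mre : measurable_fun setT
  (fun z : ('rV[R]_d * 'rV[R]_d)%type => h z.2 * cos (dotp z.1 z.2) - 1).
Proof. by apply: measurable_funB => //; apply: measurable_funM => //; exact: measurable_cos. Qed.

Let mim : measurable_fun setT
  (fun z : ('rV[R]_d * 'rV[R]_d)%type => h z.2 * sin (dotp z.1 z.2)).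
Proof. by apply: measurable_funM => //; exact: measurable_sin. Qed.

Let re_fub := Fubini_dominated M mre ih1 re_bound.
Let im_fub := Fubini_dominated M mim ih1 im_bound.

Lemma integrable_tilt_re xi :
  lam.-integrable setT (EFin \o (fun y => h y * cos (dotp xi y) - 1)).
Proof. by have [_ i2 _ _ _] := re_fub; exact: i2. Qed.

Lemma integrable_tilt_im xi :
  lam.-integrable setT (EFin \o (fun y => h y * sin (dotp xi y))).
Proof. by have [_ i2 _ _ _] := im_fub; exact: i2. Qed.

Lemma measurable_tilt_re : measurable_fun setT tilt_re.
Proof. by have [_ _ m1 _ _] := re_fub; exact: m1. Qed.

Lemma measurable_tilt_im : measurable_fun setT tilt_im.
Proof. by have [_ _ m1 _ _] := im_fub; exact: m1. Qed.

Lemma tilt_re_bound xi : `|tilt_re xi| <= tilt_bound.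
Proof.
have ir := integrable_tilt_re xi.
rewrite (le_trans (le_normr_Rintegral _ ir))//; apply: le_Rintegral => //.
exact: integrable_norm.
Qed.

Lemma tilt_im_bound xi : `|tilt_im xi| <= tilt_bound.
Proof.
have ir := integrable_tilt_im xi.
rewrite (le_trans (le_normr_Rintegral _ ir))//; apply: le_Rintegral => //.
exact: integrable_norm.
Qed.

(* The real part of int e^(- i xi.x) (P + i Q)(xi) dM(xi). *)
Definition trig_integral (P Q : 'rV[R]_d -> R) x :=
  \int[M]_xi (cos (dotp xi x) * P xi + sin (dotp xi x) * Q xi).

Lemma integrable_trig (P Q : 'rV[R]_d -> R) c x :
  measurable_fun setT P -> measurable_fun setT Q ->
  (forall xi, `|P xi| <= c) -> (forall xi, `|Q xi| <= c) ->
  M.-integrable setT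
    (EFin \o (fun xi => cos (dotp xi x) * P xi + sin (dotp xi x) * Q xi)).
Proof.
move=> mP mQ Pc Qc; apply: (@finite_bounded_integrable _ _ _ M _ (c + c)).
  by apply: measurable_funD; apply: measurable_funM => //;
    [apply: measurable_cos|apply: measurable_sin]; exact: measurable_dotp.
move=> xi; rewrite (le_trans (ler_normD _ _))// !normrM lerD//.
  by rewrite -[leRHS]mul1r ler_pM// cos_max.
by rewrite -[leRHS]mul1r ler_pM// sin_max.
Qed.

(** The operator f -> int (h(y) f(x - y) - f(x)) lam(dy) multiplies e^{- i xi.x} by the symbol
    [tilt_re] + i [tilt_im]. By Fubini it therefore acts on trigonometric integrals by multiplying P
    + i Q by this symbol. *)
Lemma trig_integral_shift (P Q : 'rV[R]_d -> R) c x :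
  measurable_fun setT P -> measurable_fun setT Q ->
  (forall xi, `|P xi| <= c) -> (forall xi, `|Q xi| <= c) ->
  lam.-integrable setT
    (EFin \o (fun y => h y * trig_integral P Q (x - y) - trig_integral P Q x)) /\
  \int[lam]_y (h y * trig_integral P Q (x - y) - trig_integral P Q x) =
  trig_integral (fun xi => tilt_re xi * P xi - tilt_im xi * Q xi)
                (fun xi => tilt_im xi * P xi + tilt_re xi * Q xi) x.
Proof.
move=> mP mQ Pc Qc.
pose G (xi z : 'rV[R]_d) := cos (dotp xi z) * P xi + sin (dotp xi z) * Q xi.
have Gc xi z : `|G xi z| <= c + c.
  rewrite (le_trans (ler_normD _ _))// !normrM lerD//.
    by rewrite -[leRHS]mul1r ler_pM// cos_max.
  by rewrite -[leRHS]mul1r ler_pM// sin_max.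
have c0 : 0 <= c by exact: le_trans (normr_ge0 _) (Pc 0).
pose f (z : ('rV[R]_d * 'rV[R]_d)%type) := h z.2 * G z.1 (x - z.2) - G z.1 x.
(* Rotation by the angle xi.y: the second bracket is minus the imaginary part of e^{- i xi.x} (P + i
   Q). *)
have GE xi y : G xi (x - y) =
    cos (dotp xi y) * G xi x + sin (dotp xi y) * (sin (dotp xi x) * P xi - cos (dotp xi x) * Q xi).
  by rewrite /G dotpBr cosB sinB; ring.
have mG z : measurable_fun setT (G ^~ z).
  by apply: measurable_funD; apply: measurable_funM => //;
    [apply: measurable_cos|apply: measurable_sin]; exact: measurable_dotp.
have mf : measurable_fun setT f.
  have m1 (g : 'rV[R]_d -> R) : measurable_fun setT g ->
      measurable_fun setT (fun z : ('rV[R]_d * 'rV[R]_d)%type => g z.1).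
    by move=> mg; apply: (measurableT_comp mg); exact: measurable_fst.
  apply: measurable_funB; last exact: (m1 _ (mG x)).
  apply: measurable_funM => //.
  rewrite (_ : (fun _ => _) = (fun z : ('rV[R]_d * 'rV[R]_d)%type =>
    cos (dotp z.1 z.2) * G z.1 x + sin (dotp z.1 z.2) *
      (sin (dotp z.1 x) * P z.1 - cos (dotp z.1 x) * Q z.1))); last first.
    by apply/funext => z; exact: GE.
  apply: measurable_funD; apply: measurable_funM.
  - exact: measurable_cos.
  - exact: (m1 _ (mG x)).
  - exact: measurable_sin.
  - apply: (m1 (fun xi => sin (dotp xi x) * P xi - cos (dotp xi x) * Q xi)).
    by apply: measurable_funB; apply: measurable_funM => //;
      [apply: measurable_sin|apply: measurable_cos]; exact: measurable_dotp.
have ig : lam.-integrable setT (EFin \o (fun y => (c + c) * (h y + 1))).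
  exact: integrable_mulrl.
have fg xi y : `|f (xi, y)| <= (c + c) * (h y + 1).
  rewrite (le_trans (ler_normB _ _))// [leRHS]mulrDr [in leRHS]mulr1 lerD//.
  by rewrite normrM (ger0_norm (h_ge0 y)) mulrC ler_wpM2r.
have iG z : M.-integrable setT (EFin \o (G ^~ z)).
  exact: (finite_bounded_integrable M (mG z) (Gc ^~ z)).
have [_ _ _ i2 [fub _]] := Fubini_dominated M mf ig fg.
have inner y : \int[M]_xi f (xi, y) = h y * trig_integral P Q (x - y) - trig_integral P Q x.
  rewrite /f RintegralB//=; last first.
    by apply: integrable_mulrl; exact: iG.
  by rewrite RintegralZl//; exact: iG.
split; first by move: i2; under eq_fun do rewrite /= inner.
rewrite -(eq_Rintegral _ (fun y _ => inner y)) -fub; apply: eq_Rintegral => xi _.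
have ir := integrable_tilt_re xi; have ii := integrable_tilt_im xi.
have -> : \int[lam]_y f (xi, y) = \int[lam]_y (G xi x * (h y * cos (dotp xi y) - 1) +
    (sin (dotp xi x) * P xi - cos (dotp xi x) * Q xi) * (h y * sin (dotp xi y))).
  by apply: eq_Rintegral => y _; rewrite /f /= GE; ring.
rewrite RintegralD//; [|exact: integrable_mulrl|exact: integrable_mulrl].
by rewrite !RintegralZl// -/(tilt_re xi) -/(tilt_im xi) /G; ring.
Qed.

Variable sigma : R.

(** One Euler step: for sigma = t / k its k-th power approximates the exponential of t times the
    symbol. *)
Definition tilt_factor xi : R[i] := Complex (1 + sigma * tilt_re xi) (sigma * tilt_im xi).

Definition tilt_power j := trig_integral
  (fun xi => complex.Re (tilt_factor xi ^+ j)) (fun xi => complex.Im (tilt_factor xi ^+ j)).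

Let ReM (z w : R[i]) : complex.Re (z * w) =
  complex.Re z * complex.Re w - complex.Im z * complex.Im w.
Proof. by case: z w => [? ?] []. Qed.

Let ImM (z w : R[i]) : complex.Im (z * w) =
  complex.Re z * complex.Im w + complex.Im z * complex.Re w.
Proof. by case: z w => [? ?] []. Qed.

Lemma tilt_factor_power_measurable j :
  measurable_fun setT (fun xi => complex.Re (tilt_factor xi ^+ j)) /\
  measurable_fun setT (fun xi => complex.Im (tilt_factor xi ^+ j)).
Proof.
have mr := measurable_tilt_re; have mi := measurable_tilt_im.
elim: j => [|j [IHr IHi]]; first by under eq_fun do rewrite expr0;
  under [X in _ /\ measurable_fun _ X]eq_fun do rewrite expr0.
split.
  under eq_fun do rewrite exprS ReM /=.
  by apply: measurable_funB; apply: measurable_funM => //;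
    [apply: measurable_funD => //|]; exact: measurable_funM.
under eq_fun do rewrite exprS ImM /=.
by apply: measurable_funD; apply: measurable_funM => //;
  [apply: measurable_funD => //|]; exact: measurable_funM.
Qed.

(** A crude bound that grows with [j] and serves integrability only; the modulus is estimated
    sharply in [tilt_power_le]. *)
Lemma tilt_factor_power_bound j xi :
  `|complex.Re (tilt_factor xi ^+ j)| <= (1 + 2 * `|sigma| * tilt_bound) ^+ j /\
  `|complex.Im (tilt_factor xi ^+ j)| <= (1 + 2 * `|sigma| * tilt_bound) ^+ j.
Proof.
set C := 1 + _.
have b0 : 0 <= tilt_bound by exact: le_trans (normr_ge0 _) (tilt_re_bound 0).
have rb : `|complex.Re (tilt_factor xi)| <= 1 + `|sigma| * tilt_bound.
  rewrite /= (le_trans (ler_normD _ _))// normr1 lerD2l normrM.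
  by rewrite ler_wpM2l// tilt_re_bound.
have ib : `|complex.Im (tilt_factor xi)| <= `|sigma| * tilt_bound.
  by rewrite /= normrM ler_wpM2l// tilt_im_bound.
have CE : C = (1 + `|sigma| * tilt_bound) + `|sigma| * tilt_bound by rewrite /C; ring.
move: (tilt_factor xi) rb ib => z rb ib.
elim: j => [|j [IHr IHi]]; first by rewrite !expr0 /= normr1 normr0.
have CS : C ^+ j.+1 = (1 + `|sigma| * tilt_bound) * C ^+ j + `|sigma| * tilt_bound * C ^+ j.
  by rewrite exprS {1}CE mulrDl.
rewrite CS exprS ReM ImM; split.
  by rewrite (le_trans (ler_normB _ _))// !normrM lerD// ler_pM.
by rewrite (le_trans (ler_normD _ _))// !normrM lerD// ler_pM.
Qed.

(** Another factor in the integrand amounts to adding [sigma] times the operator of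
    [trig_integral_shift]. The recursion refers only to values of [tilt_power j] at translates of
    [x], which opens the way to induction on [j]. *)
Lemma tilt_powerS j x :
  lam.-integrable setT
    (EFin \o (fun y => h y * tilt_power j (x - y) - tilt_power j x)) /\
  tilt_power j.+1 x =
  tilt_power j x + sigma * \int[lam]_y (h y * tilt_power j (x - y) - tilt_power j x).
Proof.
have [mr mi] := tilt_factor_power_measurable j.
have b xi := tilt_factor_power_bound j xi.
have [i1 e1] := trig_integral_shift x mr mi (fun xi => (b xi).1) (fun xi => (b xi).2).
split; first exact: i1.
have b0 : 0 <= tilt_bound by exact: le_trans (normr_ge0 _) (tilt_re_bound 0).
set C := _ ^+ j in b.
have C0 : 0 <= C by exact: le_trans (normr_ge0 _) (b 0).1.
have bb xi (p q : R) : `|p| <= C -> `|q| <= C ->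
    `|tilt_re xi * p| + `|tilt_im xi * q| <= tilt_bound * C + tilt_bound * C /\
    `|tilt_im xi * p| + `|tilt_re xi * q| <= tilt_bound * C + tilt_bound * C.
  by move=> pC qC; rewrite !normrM; split; rewrite lerD// ler_pM ?tilt_re_bound ?tilt_im_bound.
have mtr := measurable_tilt_re; have mti := measurable_tilt_im.
have i2 : M.-integrable setT (EFin \o (fun xi =>
    cos (dotp xi x) * (tilt_re xi * complex.Re (tilt_factor xi ^+ j) -
      tilt_im xi * complex.Im (tilt_factor xi ^+ j)) +
    sin (dotp xi x) * (tilt_im xi * complex.Re (tilt_factor xi ^+ j) +
      tilt_re xi * complex.Im (tilt_factor xi ^+ j)))).
  apply: (@integrable_trig _ _ (tilt_bound * C + tilt_bound * C)).
  - by apply: measurable_funB; exact: measurable_funM.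
  - by apply: measurable_funD; exact: measurable_funM.
  - move=> xi; rewrite (le_trans (ler_normB _ _))//.
    by have [] := bb xi _ _ (b xi).1 (b xi).2.
  - move=> xi; rewrite (le_trans (ler_normD _ _))//.
    by have [] := bb xi _ _ (b xi).1 (b xi).2.
have i3 := integrable_trig x mr mi (fun xi => (b xi).1) (fun xi => (b xi).2).
rewrite [X in _ + sigma * X]e1 {1}/tilt_power /trig_integral -RintegralZl// -RintegralD//.
  by apply: eq_Rintegral => xi _; rewrite exprS ReM ImM /=; ring.
exact: integrable_mulrl.
Qed.

End shift_operator.

Lemma trig_integral_translate (R : realType) (d : nat) (M : probability 'rV[R]_d R)
    (s : R) (xi0 : 'rV[R]_d) : s != 0 ->
  centered_gaussian s M -> forall x,
  trig_integral M (cst 1) (cst 0) x =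
    expR (dotp xi0 xi0 / (2 * s ^+ 2)) * expR (- dotp xi0 x) *
    trig_integral M (cst 1) (cst 0) (x - (s ^- 2) *: xi0).
Proof.
move=> s0 hM x.
have E z : trig_integral M (cst 1) (cst 0) z = expR (- s ^+ 2 * dotp z z / 2).
  by rewrite -(hM z).1; apply: eq_Rintegral => v _; rewrite mulr1 mulr0 addr0.
rewrite !E -!expRD dotpBl !dotpBr !dotpZr ![dotp (_ *: _) _]dotpC !dotpZr (dotpC x xi0).
by congr expR; field.
Qed.

(** The induction hypothesis is used at [x] and at every x - y, hence the quantification over the
    point. At x - y its prefactor contributes an extra e^{xi0.y}, which is exactly the weight that
    replaces h = 1 on the right. *)
Lemma tilt_power_translate (R : realType) (d : nat)
    (lam : {finite_measure set 'rV[R]_d -> \bar R}) (M : probability 'rV[R]_d R)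
    (s : R) (xi0 : 'rV[R]_d) (sigma : R) : s != 0 ->
  centered_gaussian s M ->
  lam.-integrable setT (EFin \o (fun y => expR (dotp xi0 y))) ->
  forall j x, tilt_power lam M (cst 1) sigma j x =
    expR (dotp xi0 xi0 / (2 * s ^+ 2)) * expR (- dotp xi0 x) *
    tilt_power lam M (fun y => expR (dotp xi0 y)) sigma j (x - (s ^- 2) *: xi0).
Proof.
move=> s0 hM ie.
have i1 : lam.-integrable setT (EFin \o cst (1 : R)).
  exact: (@finite_measure_integrable_cst _ _ _ lam setT 1).
have e0 y : 0 <= expR (dotp xi0 y) by exact: expR_ge0.
elim=> [|j IH] x.
  have E h z : tilt_power lam M h sigma 0 z = trig_integral M (cst 1) (cst 0) z.
    by apply: eq_Rintegral => v _; rewrite expr0.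
  by rewrite !E (trig_integral_translate xi0 s0 hM).
have [_ ->] := tilt_powerS M (fun=> ler01) i1 sigma j x.
set K := expR _ * expR _.
have [i2 ->] := tilt_powerS M e0 ie sigma j (x - s ^- 2 *: xi0).
rewrite IH -/K mulrDr; congr (_ + _).
rewrite mulrCA; congr (_ * _); rewrite -(RintegralZl K measurableT i2).
apply: eq_Rintegral => y _; rewrite mul1r !IH dotpBr opprD opprK expRD.
by rewrite addrAC -/K /K; ring.
Qed.

Section exponential_approximation.
Context (R : realType).

Lemma ler_norm_subX (a b : R) k : `|a| <= 1 -> `|b| <= 1 ->
  `|a ^+ k - b ^+ k| <= k%:R * `|a - b|.
Proof.
move=> a1 b1; elim: k => [|k IH]; first by rewrite !expr0 subrr normr0 mul0r.
have -> : a ^+ k.+1 - b ^+ k.+1 = a * (a ^+ k - b ^+ k) + (a - b) * b ^+ k.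
  by rewrite !exprS; ring.
rewrite (le_trans (ler_normD _ _))// !normrM -natr1 mulrDl mul1r lerD//.
  by rewrite (le_trans _ IH)// ler_piMl.
by rewrite ler_piMr// normrX exprn_ile1.
Qed.

(** Both sides are k-th powers of numbers in [0, 1], so the error is at most k times that of one
    factor, and 1 - v <= e^{-v} <= 1 / (1 + v) <= 1 - v + v^2. *)
Lemma expR_approx (v : R) k : 0 <= v <= 1 ->
  `|(1 - v) ^+ k - expR (- (k%:R * v))| <= k%:R * v ^+ 2.
Proof.
move=> /andP[v0 v1]; rewrite -mulrN mulrC expRM_natr.
have e1 : 1 - v <= expR (- v) by exact: expR_ge1Dx.
have e2 : expR (- v) <= 1 - v + v ^+ 2.
  rewrite expRN (@le_trans _ _ (1 + v)^-1)//.
    by rewrite lef_pV2 ?posrE ?expR_gt0 ?expR_ge1Dx//; lra.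
  by rewrite -[leLHS]mul1r ler_pdivrMr; [nra|lra].
rewrite (le_trans (ler_norm_subX _ _ _))//.
- by rewrite ger0_norm; lra.
- by rewrite ger0_norm ?expR_ge0// expR_le1 oppr_le0.
by rewrite ler_wpM2l// ler_norml; apply/andP; split; lra.
Qed.

End exponential_approximation.

(** * The shifted bound for a finite symmetric measure *)

Section finite_levy_measure.
Context (R : realType) (d : nat).
Variables (lam : {finite_measure set 'rV[R]_d -> \bar R}) (M : probability 'rV[R]_d R).
Variables (s : R) (xi0 : 'rV[R]_d).
Hypotheses (s_neq0 : s != 0)
  (hM : centered_gaussian s M)
  (lamN : forall A, measurable A -> lam A = lam (-%R @^-1` A))
  (ie : lam.-integrable setT (EFin \o (fun y => expR (dotp xi0 y)))).

Let Psi xi := \int[lam]_y (1 - cos (dotp xi y)).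
Let Om := \int[lam]_y (cosh (dotp xi0 y) - 1).
Let e y := expR (dotp xi0 y).

Let e_ge0 y : 0 <= e y. Proof. exact: expR_ge0. Qed.

Let i1 (c : R) : lam.-integrable setT (EFin \o cst c).
Proof. exact: (@finite_measure_integrable_cst _ _ _ lam setT c). Qed.

Let mdot xi : measurable_fun setT (fun y : 'rV[R]_d => dotp xi y).
Proof. exact: measurable_dotp. Qed.

Let iPsi xi : lam.-integrable setT (EFin \o (fun y => 1 - cos (dotp xi y))).
Proof.
apply: integrable_subr; first exact: i1.
by apply: (@finite_bounded_integrable _ _ _ lam _ 1) => [|y];
  [apply: measurable_cos; exact: mdot|exact: cos_max].
Qed.

Let ieN : lam.-integrable setT (EFin \o (fun y => e (- y))).
Proof. exact: (integrable_comp (@measurable_oppr_rV R d) lamN ie). Qed.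

Lemma tilt_re1 xi : tilt_re lam (cst 1) xi = - Psi xi.
Proof.
rewrite -mulN1r -(RintegralZl (-1) measurableT (iPsi xi)).
by apply: eq_Rintegral => y _; rewrite /cst; ring.
Qed.

Lemma tilt_im1 xi : tilt_im lam (cst 1) xi = 0.
Proof.
apply: (Rintegral_odd (@measurable_oppr_rV R d) lamN) => [y|].
  by rewrite /= dotpNr sinN mulrN.
exact: (integrable_tilt_im M (fun=> ler01) (i1 1)).
Qed.

Lemma tilt_power1 sigma k x : tilt_power lam M (cst 1) sigma k x =
  \int[M]_xi (cos (dotp xi x) * (1 - sigma * Psi xi) ^+ k).
Proof.
apply: eq_Rintegral => xi _; rewrite /tilt_factor tilt_re1 tilt_im1 mulr0 mulrN.
have -> : Complex (1 - sigma * Psi xi) 0 ^+ k = Complex ((1 - sigma * Psi xi) ^+ k) 0.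
  by rewrite -[LHS](rmorphXn (real_complex R)).
by rewrite /= mulr0 addr0.
Qed.

Lemma finite_exponent_ge0 xi : 0 <= Psi xi.
Proof. by apply: Rintegral_ge0 => y _; rewrite subr_ge0 cos_le1. Qed.

Let m := fine (lam setT).

Lemma finite_exponent_le xi : Psi xi <= 2 * m.
Proof.
rewrite -Rintegral_cst//; apply: le_Rintegral => // [|y _]; first exact: i1.
by have := cos_geN1 (dotp xi y); lra.
Qed.

Lemma measurable_finite_exponent : measurable_fun setT Psi.
Proof.
have := measurable_tilt_re M (fun=> ler01) (i1 1).
rewrite (_ : tilt_re _ _ = fun xi => - Psi xi); last by apply/funext => xi; exact: tilt_re1.
move=> mN; rewrite (_ : Psi = fun xi => - (- Psi xi)); last by apply/funext => xi; rewrite opprK.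
exact: measurableT_comp.
Qed.

(** Averaging the integrand over y and - y turns e^{xi0.y} into cosh(xi0.y). The pointwise
    inequality that remains is (cosh u - 1) (1 - cos v) >= 0. *)
Lemma tilt_re_le xi : tilt_re lam e xi <= Om - Psi xi.
Proof.
have ire := integrable_tilt_re M e_ge0 ie xi.
have ireN := integrable_comp (@measurable_oppr_rV R d) lamN ire.
have icosh : lam.-integrable setT (EFin \o (fun y => cosh (dotp xi0 y) - 1)).
  rewrite (_ : (fun _ => _) = fun y => 2^-1 * (e y + e (- y)) - 1); last first.
    by apply/funext => y; rewrite /cosh /e dotpNr mulrC.
  apply: integrable_subr; last exact: i1.
  apply: integrable_mulrl.
  exact: integrable_addr.
have E : tilt_re lam e xi = \int[lam]_y (e (- y) * cos (dotp xi (- y)) - 1).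
  have mre : measurable_fun setT (fun y => e y * cos (dotp xi y) - 1).
    by move/measurable_int : ire => /measurable_EFinP.
  exact: (Rintegral_pushforward (@measurable_oppr_rV R d) lamN mre ireN).
have -> : tilt_re lam e xi =
    2^-1 * \int[lam]_y ((e y * cos (dotp xi y) - 1) + (e (- y) * cos (dotp xi (- y)) - 1)).
  by rewrite RintegralD// -E -/(tilt_re lam e xi); field.
rewrite -(RintegralZl 2^-1 measurableT (integrable_addr ire ireN)).
rewrite -(RintegralB measurableT icosh (iPsi xi)).
apply: le_Rintegral => // [||y _].
- by apply: integrable_mulrl; exact: integrable_addr.
- by apply: integrable_subr; [exact: icosh|exact: iPsi].
rewrite /= /e !dotpNr cosN /cosh.
have := expR_gt0 (dotp xi0 y); have := expR_gt0 (- dotp xi0 y).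
have : 1 <= expR (dotp xi0 y) * expR (- dotp xi0 y) by rewrite -expRD subrr expR0.
have := cos_le1 (dotp xi y).
move: (expR _) (expR _) (cos _) => p q c c1 pq q0 p0.
have S2 : 2 <= p + q.
  have h : 4 <= (p + q) * (p + q) by have := sqr_ge0 (p - q); nra.
  by rewrite leNgt; apply/negP => lt; nra.
have := mulr_ge0 (_ : 0 <= 1 - c) (_ : 0 <= p + q - 2).
by rewrite !subr_ge0 => /(_ c1 S2); nra.
Qed.

(* The left side is at most |z|^k for z = tilt_factor, and |z|^2 <= e^(|z|^2 - 1). *)
Lemma tilt_power_le sigma k x xi :
  cos x * complex.Re (tilt_factor lam e sigma xi ^+ k) +
  sin x * complex.Im (tilt_factor lam e sigma xi ^+ k) <=
  expR (k%:R * (sigma * tilt_re lam e xi + sigma ^+ 2 * tilt_bound lam e ^+ 2)).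
Proof.
set z := tilt_factor _ _ _ _.
set a := tilt_re lam e xi; set b := tilt_bound lam e.
have ra := tilt_re_bound M e_ge0 ie xi; have ia := tilt_im_bound M e_ge0 ie xi.
have b0 : 0 <= b by exact: le_trans (normr_ge0 _) ra.
pose N (w : R[i]) := complex.Re w ^+ 2 + complex.Im w ^+ 2.
have NM v w : N (v * w) = N v * N w by case: v w => [? ?] [? ?]; rewrite /N /=; ring.
have NX : N (z ^+ k) = N z ^+ k.
  by elim: k => [|j IH]; rewrite ?exprS ?NM ?IH// /N !expr0/=; ring.
have Nz : N z <= expR (2 * (sigma * a + sigma ^+ 2 * b ^+ 2)).
  apply: le_trans (expR_ge1Dx _); rewrite /N /= -/a.
  have a2 : a ^+ 2 <= b ^+ 2.
    by rewrite -[leLHS]real_normK ?num_real// lerXn2r ?nnegrE// ?tilt_re_bound.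
  have c2 : tilt_im lam e xi ^+ 2 <= b ^+ 2.
    by rewrite -[leLHS]real_normK ?num_real// lerXn2r ?nnegrE// ?tilt_im_bound.
  have := sqr_ge0 sigma; move: (tilt_im _ _ _) c2 => c c2 s2.
  by rewrite -subr_ge0 [X in 0 <= X](_ : _ =
    sigma ^+ 2 * (b ^+ 2 - a ^+ 2) + sigma ^+ 2 * (b ^+ 2 - c ^+ 2));
    [rewrite addr_ge0// mulr_ge0// subr_ge0|ring].
set E := expR _; have E0 : 0 < E by exact: expR_gt0.
have NE : N (z ^+ k) <= E ^+ 2.
  rewrite NX /E -expRM_natl mulrA (mulrC 2) -mulrA expRM_natl lerXn2r ?nnegrE ?expR_ge0//.
  by rewrite /N addr_ge0 ?sqr_ge0.
move: NE; rewrite /N; move: (complex.Re _) (complex.Im _) => u v NE.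
have cs : cos x ^+ 2 + sin x ^+ 2 = 1 by exact: cos2Dsin2.
rewrite leNgt; apply/negP => lt.
have : (cos x * u + sin x * v) ^+ 2 <= u ^+ 2 + v ^+ 2.
  rewrite -subr_ge0 [X in 0 <= X](_ : _ = (sin x * u - cos x * v) ^+ 2) ?sqr_ge0//.
  rewrite -[u ^+ 2 + v ^+ 2]mul1r -cs; ring.
move: (_ + _) lt => w lt; nra.
Qed.

Let mexp t : measurable_fun setT (fun xi => expR (- t * Psi xi)).
Proof.
by apply: measurableT_comp => //; apply: measurable_funM => //; exact: measurable_finite_exponent.
Qed.

Let iexp t : 0 <= t -> M.-integrable setT (EFin \o (fun xi => expR (- t * Psi xi))).
Proof.
move=> t0; apply: (@finite_bounded_integrable _ _ _ M _ 1) => // xi.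
by rewrite ger0_norm ?expR_ge0// expR_le1 mulNr oppr_le0 mulr_ge0// finite_exponent_ge0.
Qed.

(** The Euler approximation with n = k + 1 factors and both errors explicit. Since Psi <= 2 m, the
    condition on [k] keeps sigma Psi in [0, 1]. The error t^2 b^2 / n in the exponent comes from the
    modulus estimate, where b is [tilt_bound], and (2 t m)^2 / n from [expR_approx]. *)
Lemma finite_shift_bound_step t x k : 0 <= t -> 2 * t * m <= k.+1%:R ->
  \int[M]_xi (cos (dotp xi x) * expR (- t * Psi xi)) <=
  expR (dotp xi0 xi0 / (2 * s ^+ 2)) * expR (- dotp xi0 x) *
  expR (t * Om + t ^+ 2 * tilt_bound lam e ^+ 2 * k.+1%:R^-1) *
    \int[M]_xi expR (- t * Psi xi) + (2 * t * m) ^+ 2 * k.+1%:R^-1.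
Proof.
move=> t0 tm; set n : R := k.+1%:R; have n0 : 0 < n by rewrite ltr0n.
pose sigma := t / n.
have s0 : 0 <= sigma by rewrite divr_ge0// ltW.
have v01 xi : 0 <= sigma * Psi xi <= 1.
  rewrite mulr_ge0 ?finite_exponent_ge0//= /sigma mulrAC ler_pdivrMr// mul1r.
  by rewrite (le_trans _ tm)// (_ : 2 * t * m = t * (2 * m)) ?ler_wpM2l ?finite_exponent_le//; ring.
have mcosx : measurable_fun setT (fun xi : 'rV[R]_d => cos (dotp xi x)).
  by apply: measurable_cos; exact: measurable_dotp.
have mpow : measurable_fun setT (fun xi => (1 - sigma * Psi xi) ^+ k.+1).
  apply: measurable_funX; apply: measurable_funB => //.
  by apply: measurable_funM => //; exact: measurable_finite_exponent.
have ipow : M.-integrable setT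
    (EFin \o (fun xi => cos (dotp xi x) * (1 - sigma * Psi xi) ^+ k.+1)).
  apply: (@finite_bounded_integrable _ _ _ M _ 1) => [|xi]; first exact: measurable_funM.
  have /andP[v0 v1] := v01 xi.
  rewrite normrM -[leRHS]mul1r ler_pM// ?cos_max// normrX exprn_ile1//.
  by rewrite ler_norml; apply/andP; split; lra.
have icst c : M.-integrable setT (EFin \o cst (c : R)).
  exact: (@finite_measure_integrable_cst _ _ _ M setT c).
have b0 : 0 <= tilt_bound lam e.
  exact: le_trans (normr_ge0 _) (tilt_re_bound M e_ge0 ie 0).
have stepA : \int[M]_xi (cos (dotp xi x) * (1 - sigma * Psi xi) ^+ k.+1) <=
    expR (dotp xi0 xi0 / (2 * s ^+ 2)) * expR (- dotp xi0 x) *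
    expR (t * Om + t ^+ 2 * tilt_bound lam e ^+ 2 * n^-1) * \int[M]_xi expR (- t * Psi xi).
  rewrite -tilt_power1 (tilt_power_translate _ s_neq0 hM ie) -[leRHS]mulrA.
  rewrite ler_wpM2l ?mulr_ge0 ?expR_ge0// -RintegralZl//; last exact: iexp.
  have [mr mi] := tilt_factor_power_measurable M e_ge0 ie sigma k.+1.
  have b xi := tilt_factor_power_bound M e_ge0 ie sigma k.+1 xi.
  apply: le_Rintegral => //.
  - exact: (integrable_trig M _ mr mi (fun xi => (b xi).1) (fun xi => (b xi).2)).
  - by apply: integrable_mulrl; exact: iexp.
  move=> xi _; apply: le_trans (tilt_power_le _ _ _ _) _.
  rewrite -expRD ler_expR -/n.
  have -> : n * (sigma * tilt_re lam e xi + sigma ^+ 2 * tilt_bound lam e ^+ 2) =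
      t * tilt_re lam e xi + t ^+ 2 * tilt_bound lam e ^+ 2 * n^-1.
    by rewrite /sigma; field; rewrite gt_eqF.
  rewrite mulNr addrAC -mulrBr lerD2r ler_wpM2l//; exact: tilt_re_le.
apply: (@le_trans _ _ (\int[M]_xi (cos (dotp xi x) * (1 - sigma * Psi xi) ^+ k.+1 +
   (2 * t * m) ^+ 2 * n^-1))); last first.
  rewrite RintegralD//; last exact: icst.
  by rewrite Rintegral_prob_cst lerD2r.
apply: le_Rintegral => //.
- apply: (@finite_bounded_integrable _ _ _ M _ 1) => [|xi]; first exact: measurable_funM.
  rewrite normrM -[leRHS]mul1r ler_pM// ?cos_max// ger0_norm ?expR_ge0//.
  by rewrite expR_le1 mulNr oppr_le0 mulr_ge0// finite_exponent_ge0.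
- by apply: integrable_addr => //; exact: icst.
move=> xi _; rewrite -lerBlDl -mulrBr (le_trans (ler_norm _))// normrM.
rewrite (@le_trans _ _ (1 * (n * (sigma * Psi xi) ^+ 2)))//.
  rewrite ler_pM// ?cos_max// distrC.
  have -> : - t * Psi xi = - (n * (sigma * Psi xi)).
    by rewrite /sigma; field; rewrite gt_eqF.
  exact: expR_approx.
have -> : 1 * (n * (sigma * Psi xi) ^+ 2) = (t * Psi xi) ^+ 2 * n^-1.
  by rewrite /sigma; field; rewrite gt_eqF.
rewrite ler_wpM2r ?invr_ge0 ?(ltW n0)// lerXn2r ?nnegrE//.
- by rewrite mulr_ge0// finite_exponent_ge0.
- by rewrite !mulr_ge0// fine_ge0.
by rewrite (_ : 2 * t * m = t * (2 * m)) ?ler_wpM2l ?finite_exponent_le//; ring.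
Qed.

Lemma finite_shift_bound t x : 0 <= t ->
  \int[M]_xi (cos (dotp xi x) * expR (- t * Psi xi)) <=
  expR (dotp xi0 xi0 / (2 * s ^+ 2)) * expR (- dotp xi0 x) * expR (t * Om) *
    \int[M]_xi expR (- t * Psi xi).
Proof.
move=> t0.
set J := \int[M]_xi expR _; set K := expR _ * expR _.
pose B := t ^+ 2 * tilt_bound lam e ^+ 2; pose D := (2 * t * m) ^+ 2.
have cvg : (fun k : nat => K * expR (t * Om + B * k.+1%:R^-1) * J + D * k.+1%:R^-1) @ \oo -->
    K * expR (t * Om) * J.
  have h : (fun k : nat => (k.+1%:R^-1 : R)) @ \oo --> 0 by exact: cvg_harmonic.
  rewrite -[X in _ --> X]addr0 -[X in _ --> _ + X](mulr0 D).
  apply: cvgD; last by apply: cvgM => //; exact: cvg_cst.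
  apply: cvgM; last exact: cvg_cst.
  apply: cvgM; first exact: cvg_cst.
  apply: continuous_cvg; first exact: continuous_expR.
  rewrite -[X in _ --> X]addr0 -[X in _ --> _ + X](mulr0 B).
  by apply: cvgD; [exact: cvg_cst|apply: cvgM => //; exact: cvg_cst].
rewrite -(cvg_lim _ cvg)//; apply: limr_ge; first by apply/cvg_ex; eexists; exact: cvg.
exists (Num.truncn (2 * t * m)) => // k /= tk.
apply: finite_shift_bound_step => //.
by rewrite ltW// (lt_le_trans (truncnS_gt _))// ler_nat.
Qed.

End finite_levy_measure.

(** * Truncation of the Levy measure *)

Section trigonometric_bounds.
Context (R : realType).
Implicit Types u : R.

(** Two uses of the mean value theorem, for cos on [0, u] and then for sin on [0, c]. The constant 1
    is good enough for domination. *)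
Lemma subr1_cos_le_sqr u : 1 - cos u <= u ^+ 2.
Proof.
wlog u0 : u / 0 <= u.
  by move=> H; have [/H//|/ltW u0] := leP 0 u; rewrite -cosN -sqrrN H// oppr_ge0.
have cc (f : R -> R) (df : R -> R) (a b : R) : (forall z : R, is_derive z (1 : R) f (df z)) ->
    {within `[a, b], continuous f}.
  move=> fd; apply: continuous_subspaceT => z.
  by apply/differentiable_continuous/derivable1_diffP; have [] := fd z.
have [c cu] := MVT_segment u0 (fun z _ => is_derive_cos z) (cc _ _ _ _ (fun z => is_derive_cos z)).
move: cu; rewrite in_itv/= => /andP[c0 cu].
have [c' _] := MVT_segment c0 (fun z _ => is_derive_sin z) (cc _ _ _ _ (fun z => is_derive_sin z)).
rewrite sin0 cos0 !subr0 => -> h.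
have -> : 1 - cos u = cos c' * c * u by rewrite -opprB h; ring.
rewrite expr2 ler_wpM2r// (le_trans _ cu)// ler_piMl// cos_le1.
Qed.

Lemma cosh_ge1 u : 1 <= cosh u.
Proof.
rewrite /cosh ler_pdivlMr// mul1r.
have := expR_gt0 u; have : expR u * expR (- u) = 1 by rewrite -expRD subrr expR0.
have := expR_gt0 (- u); move: (expR u) (expR _) => p q q0 pq p0.
have h : 4 <= (p + q) * (p + q) by have := sqr_ge0 (p - q); nra.
by rewrite leNgt; apply/negP => lt; nra.
Qed.

(** For u >= 0, cosh u - 1 = e^u (1 - e^{-u})^2 / 2 and 0 <= 1 - e^{-u} <= u. *)
Lemma cosh_subr1_le u : cosh u - 1 <= u ^+ 2 * expR `|u|.
Proof.
wlog u0 : u / 0 <= u.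
  move=> H; have [/H//|/ltW u0] := leP 0 u.
  by rewrite -normrN -sqrrN -(_ : cosh (- u) = cosh u) ?H ?oppr_ge0// /cosh opprK addrC.
rewrite ger0_norm//.
have pq : expR u * expR (- u) = 1 by rewrite -expRD subrr expR0.
have q1 : 1 - expR (- u) <= u by have := expR_ge1Dx (- u); lra.
have q2 : 0 <= 1 - expR (- u) by rewrite subr_ge0 expR_le1 oppr_le0.
have -> : cosh u - 1 = expR u * (1 - expR (- u)) ^+ 2 / 2.
  rewrite /cosh; move: (expR u) (expR (- u)) pq => p q pq.
  have -> : p * (1 - q) ^+ 2 = p - 2 * (p * q) + q * (p * q) by ring.
  by rewrite pq; field.
rewrite mulrC mulrCA (mulrC (u ^+ 2)) ler_wpM2l ?expR_ge0//.
have := lerXn2r 2 (_ : 1 - expR (- u) \in Num.nneg) (_ : u \in Num.nneg) q1.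
rewrite !nnegrE => /(_ q2 u0); have := sqr_ge0 (1 - expR (- u)).
by move: ((1 - _) ^+ 2) (u ^+ 2) => r v r0 rv; lra.
Qed.

End trigonometric_bounds.

Section euclidean_norm.
Context (R : realType) (d : nat).
Implicit Types x y : 'rV[R]_d.

Lemma sqr_enorm y : enorm y ^+ 2 = dotp y y.
Proof. by rewrite sqr_sqrtr// dotp_ge0. Qed.

Lemma enorm_ge0 y : 0 <= enorm y. Proof. exact: sqrtr_ge0. Qed.

Lemma enormN y : enorm (- y) = enorm y.
Proof. by rewrite /enorm dotpNr dotpC dotpNr opprK. Qed.

Lemma enorm0 : enorm (0 : 'rV[R]_d) = 0.
Proof. by rewrite /enorm /dotp big1 ?sqrtr0// => i _; rewrite mxE mul0r. Qed.

Lemma enorm_gt0 y : y != 0 -> 0 < enorm y.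
Proof.
apply: contra_neqT; rewrite -leNgt => y0.
have : dotp y y = 0.
  by rewrite -sqr_enorm (_ : enorm y = 0) ?expr0n//; apply/eqP; rewrite eq_le y0 enorm_ge0.
move=> /eqP; rewrite psumr_eq0; last by move=> i _; rewrite -expr2 sqr_ge0.
move=> /allP h; apply/rowP => i; rewrite mxE.
by have := h i (mem_index_enum _); rewrite /= -expr2 sqrf_eq0 => /eqP.
Qed.

Lemma coord_le_enorm y i : `|y 0 i| <= enorm y.
Proof.
rewrite -sqrtr_sqr ler_sqrt ?dotp_ge0// /dotp (bigD1 i)//= expr2 lerDl.
by apply: sumr_ge0 => j _; rewrite -expr2 sqr_ge0.
Qed.

Lemma norm_dotp_le x y : `|dotp x y| <= (\sum_i `|x 0 i|) * enorm y.
Proof.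
rewrite (le_trans (ler_norm_sum _ _ _))// mulr_suml ler_sum// => i _.
by rewrite normrM ler_wpM2l// coord_le_enorm.
Qed.

Lemma measurable_enorm : measurable_fun setT (@enorm R d).
Proof.
apply: measurableT_comp; last exact: measurable_dotp.
by apply: continuous_measurable_fun; exact: sqrt_continuous.
Qed.

Lemma measurable_enorm_ge (c : R) : measurable [set y : 'rV[R]_d | c <= enorm y].
Proof.
have := measurable_enorm measurableT (measurable_itv `[c, +oo[).
by rewrite setTI (_ : _ @^-1` _ = [set y | c <= enorm y])//;
  apply/seteqP; split => y /=; rewrite in_itv/= andbT.
Qed.

End euclidean_norm.

(** The restricted measure has density [\1_A] with respect to [m]. *)
Lemma integral_mfrestr d (T : measurableType d) (R : realType)
    (m : {measure set T -> \bar R}) (A : set T) (mA : measurable A)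
    (moo : (m A < +oo)%E) (f : T -> R) :
  measurable_fun setT f -> (forall x, 0 <= f x) ->
  (\int[mfrestr mA moo]_x (f x)%:E = \int[m]_(x in A) (f x)%:E)%E.
Proof.
move=> mf f0.
have mrE B : measurable B -> mfrestr mA moo B = (\int[m]_(x in B) (\1_A x)%:E)%E.
  by move=> mB; rewrite integral_indic// setIC.
rewrite (integral_density _ _ mrE)//.
rewrite [RHS]integral_mkcond; apply: eq_integral => x _.
by rewrite patchE indicE; case: ifPn => _ /=; rewrite ?mulr1 ?mulr0.
Qed.

Section levy_measure.
Context (R : realType) (d : nat) (nu : {measure set 'rV[R]_d -> \bar R}).
Hypothesis nu_levy : symmetric_levy_measure nu.

Let nuN (A : set 'rV[R]_d) : measurable A -> ~ A 0 -> nu A = nu (-%R @^-1` A).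
Proof.
have [_ sym _] := nu_levy => mA A0; rewrite sym//; congr (nu _).
apply/seteqP; split => y /=; first by move=> [z Az <-]; rewrite opprK.
by move=> Ay; exists (- y) => //; rewrite opprK.
Qed.

(** The integrands that define the Levy weight, the exponent and omega vanish at the origin, so they
    can be integrated over the whole space. *)
Lemma punctured_integral (f : 'rV[R]_d -> \bar R) : f 0 = 0%E ->
  (\int[nu]_(y in ~` [set 0%R]) f y = \int[nu]_y f y)%E.
Proof.
move=> f0; rewrite integral_mkcond; apply: eq_integral => y _.
rewrite patchE; case: ifPn => //; rewrite notin_setE /= => /contrapT ->.
by rewrite f0.
Qed.

Lemma punctured_Rintegral (f : 'rV[R]_d -> R) : f 0 = 0 ->
  \int[nu]_(y in ~` [set 0]) f y = \int[nu]_y f y.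
Proof. by move=> f0; rewrite /Rintegral punctured_integral// f0. Qed.

Let W (y : 'rV[R]_d) : R := Num.min 1 (enorm y ^+ 2).

Let W_ge0 y : 0 <= W y.
Proof. by rewrite /W le_min ler01 sqr_ge0. Qed.

Let mW : measurable_fun setT W.
Proof.
by apply: measurable_minr => //; apply: measurable_funX; exact: measurable_enorm.
Qed.

Lemma integrable_levy_weight : nu.-integrable setT (EFin \o W).
Proof.
have [_ _ fin] := nu_levy; apply/integrableP; split; first exact/measurable_EFinP.
under eq_integral do rewrite /= ger0_norm//.
by rewrite -punctured_integral// /W enorm0 expr0n /= min_r.
Qed.

Definition away0 n : set 'rV[R]_d := [set y | n.+1%:R^-1 <= enorm y].

Lemma measurable_away0 n : measurable (away0 n).
Proof. exact: measurable_enorm_ge. Qed.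

(** Markov's inequality for the Levy weight, which is at least c^2 on [away0 n] because c <= 1. *)
Lemma away0_lty n : (nu (away0 n) < +oo)%E.
Proof.
set c : R := n.+1%:R^-1.
have c0 : 0 < c by rewrite invr_gt0.
have c1 : c <= 1 by rewrite invf_le1// ler1n.
have mA := measurable_away0 n.
have AW y : away0 n y -> c ^+ 2 <= W y.
  move=> /= cy; rewrite /W le_min exprn_ile1 ?(ltW c0)//=.
  by rewrite lerXn2r ?nnegrE ?(ltW c0) ?enorm_ge0.
have : ((c ^+ 2)%:E * nu (away0 n) < +oo)%E.
  have := integrable_lty measurableT integrable_levy_weight.
  apply: le_lt_trans.
  rewrite -integral_cst//; apply: (@le_trans _ _ (\int[nu]_(y in away0 n) (W y)%:E)%E).
    apply: ge0_le_integral => //.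
    - by move=> y _; rewrite lee_fin sqr_ge0.
    - by apply/measurable_funTS/measurable_EFinP.
  by apply: ge0_subset_integral => //; [exact/measurable_EFinP|move=> y _; rewrite lee_fin].
rewrite !ltey; apply: contra => /eqP ->.
by rewrite mulry gtr0_sg ?exprn_gt0// mul1e.
Qed.

Definition truncated_measure n := mfrestr (measurable_away0 n) (away0_lty n).

(** [away0 n] is symmetric, and its intersection with any set misses the origin, so the symmetry of
    [nu] applies to it. *)
Lemma truncated_measureN n A : measurable A ->
  truncated_measure n A = truncated_measure n (-%R @^-1` A).
Proof.
move=> mA; rewrite /truncated_measure /mfrestr /mrestr nuN.
- by congr (nu _); apply/seteqP; split => y /=; rewrite /away0/= enormN.
- by apply: measurableI => //; exact: measurable_away0.
by move=> [_]; rewrite /away0/= enorm0 leNgt invr_gt0 ltr0n.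
Qed.

Variable xi0 : 'rV[R]_d.
Hypothesis xi0_moment :
  (\int[nu]_(y in [set y | (1 <= enorm y)%R]) (expR (dotp xi0 y))%:E < +oo)%E.

Let mdot (xi : 'rV[R]_d) : measurable_fun setT (fun y : 'rV[R]_d => dotp xi y).
Proof. exact: measurable_dotp. Qed.

Let me : measurable_fun setT (fun y : 'rV[R]_d => expR (dotp xi0 y)).
Proof. by apply: measurableT_comp => //; exact: mdot. Qed.

(** The l^1 norm of [xi0], for which |xi0.y| <= L |y|. *)
Let L := \sum_i `|xi0 0 i|.

Let L_ge0 : 0 <= L. Proof. exact: sumr_ge0. Qed.

Let far : set 'rV[R]_d := [set y | 1 <= enorm y].
Let mfar : measurable far. Proof. exact: measurable_enorm_ge. Qed.

Let farexp y := expR (dotp xi0 y) * \1_far y.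

Let ifar : nu.-integrable setT (EFin \o farexp).
Proof.
apply/integrableP; split.
  by apply/measurable_EFinP/measurable_funM => //; exact: measurable_indic.
under eq_integral do rewrite /= ger0_norm ?mulr_ge0 ?expR_ge0//.
apply: le_lt_trans xi0_moment; rewrite le_eqVlt; apply/orP; left; apply/eqP.
rewrite [RHS]integral_mkcond; apply: eq_integral => y _.
by rewrite /farexp patchE indicE; case: ifPn => _; rewrite /= ?mulr1 ?mulr0.
Qed.

Let mfarexp : measurable_fun setT farexp.
Proof. by move/measurable_int : ifar => /measurable_EFinP. Qed.

Let near_le (y : 'rV[R]_d) : ~ far y -> `|dotp xi0 y| <= L /\ W y = enorm y ^+ 2.
Proof.
move=> /negP; rewrite -ltNge => y1; split.
  by rewrite (le_trans (norm_dotp_le _ _))// ler_piMr// ltW.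
by rewrite /W min_r// exprn_ile1 ?enorm_ge0// ltW.
Qed.

(** For |y| >= 1 this is the moment hypothesis; for |y| < 1 the integrand is at most e^L, on a set
    of finite measure. *)
Lemma integrable_truncated_expR n :
  (truncated_measure n).-integrable setT (EFin \o (fun y => expR (dotp xi0 y))).
Proof.
have mA := measurable_away0 n.
have ef y : expR (dotp xi0 y) <= farexp y + expR L.
  have [fy|nfy] := pselect (far y).
    by rewrite /farexp indicE mem_set// mulr1 lerDl expR_ge0.
  have [yL _] := near_le nfy.
  rewrite ler_wpDl ?mulr_ge0 ?expR_ge0// ler_expR (le_trans _ yL)//.
  exact: ler_norm.
have iA : nu.-integrable (away0 n) (EFin \o (fun y => farexp y + expR L)).
  rewrite (_ : _ \o _ = (EFin \o farexp) \+ (EFin \o cst (expR L)))%E; last exact/funext.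
  apply: integrableD => //; first exact: integrableS ifar.
  apply/integrableP; split; first exact/measurable_EFinP.
  under eq_integral do rewrite /= ger0_norm ?expR_ge0//.
  by rewrite integral_cst// lte_mul_pinfty ?lee_fin ?expR_ge0 ?away0_lty.
apply/integrableP; split; first exact/measurable_EFinP.
under eq_integral do rewrite /= ger0_norm ?expR_ge0//.
rewrite integral_mfrestr//.
apply: le_lt_trans (integrable_lty mA iA); apply: ge0_le_integral => //.
- exact/measurable_funTS/measurable_EFinP.
- by move/measurable_int : iA.
- by move=> y _; rewrite lee_fin ef.
Qed.

(** [far] is [away0 0], so the symmetry of the truncated measure of index 0 carries the moment
    hypothesis from [xi0] to its opposite. *)
Let ifarN : nu.-integrable setT (EFin \o (fun y => farexp (- y))).
Proof.
have i0 := integrable_comp (@measurable_oppr_rV R d) (@truncated_measureN 0)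
  (integrable_truncated_expR 0).
have A0 : away0 0 = far by rewrite /away0 invr1.
apply/integrableP; split.
  apply/measurable_EFinP; apply: (measurableT_comp mfarexp).
  exact: measurable_oppr_rV.
move/integrableP : i0 => [/measurable_EFinP mi]; apply: le_lt_trans.
under [leRHS]eq_integral do rewrite /= ger0_norm ?expR_ge0//.
rewrite integral_mfrestr//.
rewrite [leRHS]integral_mkcond le_eqVlt; apply/orP; left; apply/eqP.
apply: eq_integral => y _; rewrite patchE A0 /= /farexp indicE.
rewrite (_ : (- y \in far) = (y \in far)); last first.
  by apply/idP/idP; rewrite !inE /far /= enormN.
by case: ifPn => _ /=; rewrite ?mulr1 ?mulr0 ?normr0 ?ger0_norm ?expR_ge0.
Qed.

(** Near the origin cosh u - 1 <= u^2 e^{|u|} is at most L^2 e^L times the Levy weight; far away the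
    two exponentials are integrable separately. *)
Lemma integrable_cosh : nu.-integrable setT (EFin \o (fun y => cosh (dotp xi0 y) - 1)).
Proof.
have ig : nu.-integrable setT (EFin \o
    (fun y => L ^+ 2 * expR L * W y + (farexp y + farexp (- y)))).
  apply: integrable_addr; last exact: integrable_addr.
  by apply: integrable_mulrl; exact: integrable_levy_weight.
apply: (dominated_integrable _ ig).
  apply: measurable_funB => //; apply: measurable_funM => //.
  by apply: measurable_funD; do 2 apply: measurableT_comp => //; exact: mdot.
move=> y; rewrite ger0_norm ?subr_ge0 ?cosh_ge1//.
have [fy|nfy] := pselect (far y).
  rewrite /farexp !indicE !mem_set//; last by rewrite /far/= enormN.
  rewrite !mulr1 dotpNr /cosh.
  have : 0 <= L ^+ 2 * expR L * W y by rewrite !mulr_ge0 ?expR_ge0.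
  have := expR_ge0 (dotp xi0 y); have := expR_ge0 (- dotp xi0 y).
  by move: (_ * W y) (expR _) (expR _) => p q r; lra.
have [yL WE] := near_le nfy.
rewrite (le_trans (cosh_subr1_le _))// ler_wpDr//.
  by rewrite addr_ge0// mulr_ge0// expR_ge0.
rewrite WE [leRHS]mulrAC ler_pM ?sqr_ge0 ?expR_ge0 ?ler_expR//.
rewrite -exprMn -[leLHS]real_normK ?num_real// lerXn2r ?nnegrE ?mulr_ge0 ?enorm_ge0//.
exact: norm_dotp_le.
Qed.

Lemma integrable_cos xi : nu.-integrable setT (EFin \o (fun y => 1 - cos (dotp xi y))).
Proof.
pose l := \sum_i `|xi 0 i|.
have l0 : 0 <= l by exact: sumr_ge0.
(* The 2 bounds 1 - cos where the weight is 1, and l^2 serves where it is |y|^2. *)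
have ig : nu.-integrable setT (EFin \o (fun y => (2 + l ^+ 2) * W y)).
  by apply: integrable_mulrl; exact: integrable_levy_weight.
apply: (dominated_integrable _ ig).
  by apply: measurable_funB => //; exact: measurable_cos.
move=> y; rewrite ger0_norm ?subr_ge0 ?cos_le1// /W /Num.min; case: ifP => _.
  by have := cos_geN1 (dotp xi y); have := sqr_ge0 l; lra.
rewrite (le_trans (subr1_cos_le_sqr _))// [leRHS]mulrDl ler_wpDl ?(mulr_ge0 _ (sqr_ge0 _))//.
rewrite -exprMn -[leLHS]real_normK ?num_real// lerXn2r ?nnegrE ?mulr_ge0 ?enorm_ge0//.
exact: norm_dotp_le.
Qed.

Lemma truncated_exponent n xi :
  \int[truncated_measure n]_y (1 - cos (dotp xi y)) =
  \int[nu]_y ((1 - cos (dotp xi y)) * \1_(away0 n) y).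
Proof.
rewrite /Rintegral integral_mfrestr//.
- rewrite integral_mkcond; congr fine; apply: eq_integral => y _.
  by rewrite patchE indicE; case: ifPn => _ /=; rewrite ?mulr1 ?mulr0.
- by apply: measurable_funB => //; exact: measurable_cos.
Qed.

Lemma truncated_exponent_cvg xi :
  (fun n => \int[truncated_measure n]_y (1 - cos (dotp xi y))) @ \oo --> levy_exponent nu xi.
Proof.
rewrite (_ : (fun _ => _) = fun n => \int[nu]_y ((1 - cos (dotp xi y)) * \1_(away0 n) y));
  last by apply/funext => n; exact: truncated_exponent.
have ic := integrable_cos xi.
rewrite /levy_exponent punctured_Rintegral; last first.
  by rewrite /dotp big1 ?cos0 ?subrr// => i _; rewrite mxE mulr0.
apply: fine_cvg; rewrite fineK; last exact: integrable_fin_num.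
apply: (@dominated_cvg _ _ _ nu setT measurableT _ _ (EFin \o (fun y => 1 - cos (dotp xi y)))).
- move=> n; apply/measurable_EFinP/measurable_funM.
    by apply: measurable_funB => //; exact: measurable_cos.
  by apply: measurable_indic; exact: measurable_away0.
- move=> y _; apply: cvg_near_cst.
  (* The origin lies in no [away0 n], but the integrand is 0 there; any other point lies in all of
     them from some rank on. *)
  have [->|y0] := eqVneq y 0.
    near=> n; rewrite (_ : dotp xi 0 = 0) ?cos0 ?subrr ?mul0r//.
    by rewrite /dotp big1// => i _; rewrite mxE mulr0.
  have ey := enorm_gt0 y0.
  near=> n; rewrite indicE mem_set ?mulr1//.
  rewrite /away0 /= invf_ple ?posrE//; near: n.
  exists (Num.truncn (enorm y)^-1) => // k /= yk.
  by rewrite ltW// (lt_le_trans (truncnS_gt _))// ler_nat.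
- by [].
- exact: ic.
- move=> n y _ /=; rewrite lee_fin normrM ger0_norm ?subr_ge0 ?cos_le1//.
  by rewrite ler_piMr ?subr_ge0 ?cos_le1// indicE; case: (_ \in _); rewrite ?normr1 ?normr0.
Unshelve. all: by end_near. Qed.

(** An inequality suffices, since omega enters only the upper bound, with the nonnegative
    coefficient t. *)
Lemma truncated_omega_le n :
  \int[truncated_measure n]_y (cosh (dotp xi0 y) - 1) <= levy_omega nu xi0.
Proof.
have ic := integrable_cosh.
rewrite /levy_omega punctured_Rintegral; last first.
  rewrite (_ : dotp xi0 0 = 0) /cosh ?oppr0 ?expR0; first by field.
  by rewrite /dotp big1// => i _; rewrite mxE mulr0.
have mc : measurable_fun setT (fun y => cosh (dotp xi0 y) - 1).
  by move/measurable_int : ic => /measurable_EFinP.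
have c0 y : 0 <= cosh (dotp xi0 y) - 1 by rewrite subr_ge0 cosh_ge1.
have mA := measurable_away0 n.
have le : (\int[nu]_(y in away0 n) (cosh (dotp xi0 y) - 1)%:E <=
    \int[nu]_y (cosh (dotp xi0 y) - 1)%:E)%E.
  by apply: ge0_subset_integral => //; [exact/measurable_EFinP|move=> y _; rewrite lee_fin].
rewrite /Rintegral integral_mfrestr// fine_le//.
- rewrite ge0_fin_numE; last by apply: integral_ge0 => y _; rewrite lee_fin.
  by apply: le_lt_trans le _; exact: integrable_lty.
- exact: integrable_fin_num.
Qed.

Lemma levy_shift_bound (M : probability 'rV[R]_d R) (s : R) : s != 0 ->
  centered_gaussian s M ->
  forall t x, 0 <= t ->
  \int[M]_xi (cos (dotp xi x) * expR (- t * levy_exponent nu xi)) <=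
  expR (dotp xi0 xi0 / (2 * s ^+ 2)) * expR (- dotp xi0 x + t * levy_omega nu xi0) *
    \int[M]_xi expR (- t * levy_exponent nu xi).
Proof.
move=> s0 hM t x t0.
pose psi n xi := \int[truncated_measure n]_y (1 - cos (dotp xi y)).
have i1 n : (truncated_measure n).-integrable setT (EFin \o cst (1 : R)).
  exact: (@finite_measure_integrable_cst _ _ _ (truncated_measure n) setT 1).
have mexp n : measurable_fun setT (fun xi => expR (- t * psi n xi)).
  apply: measurableT_comp => //; apply: measurable_funM => //.
  exact: (measurable_finite_exponent (truncated_measure n) M).
have exp1 n xi : `|expR (- t * psi n xi)| <= 1.
  rewrite ger0_norm ?expR_ge0// expR_le1 mulNr oppr_le0 mulr_ge0//.
  exact: (finite_exponent_ge0 (truncated_measure n)).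
have mlim : measurable_fun setT (fun xi => expR (- t * levy_exponent nu xi)).
  apply: measurableT_comp => //; apply: measurable_funM => //.
  apply: (@measurable_fun_cvg _ _ _ setT psi) => [n|xi _]; last exact: truncated_exponent_cvg.
  exact: (measurable_finite_exponent (truncated_measure n) M).
have lim1 xi : `|expR (- t * levy_exponent nu xi)| <= 1.
  rewrite ger0_norm ?expR_ge0// expR_le1 mulNr oppr_le0 mulr_ge0//.
  by apply: Rintegral_ge0 => y _; rewrite subr_ge0 cos_le1.
have cvg_int (f : 'rV[R]_d -> R) : measurable_fun setT f -> (forall xi, `|f xi| <= 1) ->
    (fun n => \int[M]_xi (f xi * expR (- t * psi n xi))) @ \oo -->
    \int[M]_xi (f xi * expR (- t * levy_exponent nu xi)).
  move=> mf f1.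
  have D : (\int[M]_xi (f xi * expR (- t * psi n xi))%:E @[n --> \oo] -->
      \int[M]_xi (f xi * expR (- t * levy_exponent nu xi))%:E)%E.
    apply: (@dominated_cvg _ _ _ M setT measurableT _ _ (EFin \o cst 1)).
    - by move=> n; apply/measurable_EFinP/measurable_funM.
    - move=> xi _; apply: cvg_EFin; first exact: nearW.
      apply: cvgM; first exact: cvg_cst.
      apply: continuous_cvg; first exact: continuous_expR.
      by apply: cvgM; [exact: cvg_cst|exact: truncated_exponent_cvg].
    - by [].
    - exact: (@finite_measure_integrable_cst _ _ _ M setT 1).
    - move=> n xi _; rewrite lee_fin normrM -[leRHS]mul1r ler_pM//.
  apply: fine_cvg; rewrite fineK//; apply: integrable_fin_num => //.
  apply: (@finite_bounded_integrable _ _ _ M _ 1) => [|xi]; first exact: measurable_funM.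
  by rewrite normrM -[leRHS]mul1r ler_pM.
have mcos : measurable_fun setT (fun xi : 'rV[R]_d => cos (dotp xi x)).
  by apply: measurable_cos; exact: measurable_dotp.
have cvg1 := cvg_int (fun xi => cos (dotp xi x)) mcos (fun xi => cos_max _).
have cvg2 : (fun n => \int[M]_xi expR (- t * psi n xi)) @ \oo -->
    \int[M]_xi expR (- t * levy_exponent nu xi).
  have m1 : measurable_fun setT (fun _ : 'rV[R]_d => 1 : R) by [].
  have mul1 (f : 'rV[R]_d -> R) : \int[M]_xi (1 * f xi) = \int[M]_xi f xi.
    by apply: eq_Rintegral => xi _; rewrite mul1r.
  (* The case f = 1 of [cvg_int]; the [eqbRL] term is the proof of |1| <= 1. *)
  have := cvg_int _ m1 (fun _ => eqbRL (congr1 (<=%R^~ 1) (normr1 R)) (lexx 1)).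
  by rewrite mul1; under eq_fun do rewrite mul1.
set K := expR _ * expR _.
apply: (ler_cvg_to cvg1 (cvgM (cvg_cst K) cvg2)); apply: nearW => n.
have lamN := @truncated_measureN n.
apply: le_trans (finite_shift_bound s0 hM lamN (integrable_truncated_expR n) x t0) _.
rewrite ler_wpM2r//; first by apply: Rintegral_ge0 => xi _; exact: expR_ge0.
rewrite /K expRD mulrA ler_wpM2l ?mulr_ge0 ?expR_ge0// ler_expR ler_wpM2l//.
exact: truncated_omega_le.
Qed.

End levy_measure.

(** * Gaussian smoothing of a continuous density *)

(** Both sides are the integral of cos(xi.(x - y)) under the product of [M] and [m]. Integrating in
    xi first gives the Gaussian at x - y; integrating in y first gives cos(xi.x) phi(xi), the sine
    part being 0. *)
Lemma gaussian_parseval (R : realType) d (M m : probability 'rV[R]_d R) (s : R)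
    (phi : 'rV[R]_d -> R) :
  centered_gaussian s M ->
  (forall xi, \int[m]_y cos (dotp xi y) = phi xi) ->
  (forall xi, \int[m]_y sin (dotp xi y) = 0) ->
  forall x, \int[M]_xi (cos (dotp xi x) * phi xi) =
    \int[m]_y expR (- s ^+ 2 * dotp (x - y) (x - y) / 2).
Proof.
move=> hM mcos msin x.
pose f (z : ('rV[R]_d * 'rV[R]_d)%type) := cos (dotp z.1 x) * cos (dotp z.1 z.2) +
  sin (dotp z.1 x) * sin (dotp z.1 z.2).
have fE xi y : f (xi, y) = cos (dotp xi (x - y)) by rewrite dotpBr cosB.
have mf : measurable_fun setT f.
  have d1 : measurable_fun setT (fun z : ('rV[R]_d * 'rV[R]_d)%type => dotp z.1 x).
    by apply: measurable_dotp => //; exact: measurable_fst.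
  have d2 : measurable_fun setT (fun z : ('rV[R]_d * 'rV[R]_d)%type => dotp z.1 z.2).
    by apply: measurable_dotp; [exact: measurable_fst|exact: measurable_snd].
  apply: measurable_funD; apply: measurable_funM.
  - exact: measurable_cos d1.
  - exact: measurable_cos d2.
  - exact: measurable_sin d1.
  - exact: measurable_sin d2.
have f1 xi y : `|f (xi, y)| <= 1 by rewrite fE; exact: cos_max.
have i1 : m.-integrable setT (EFin \o cst (1 : R)).
  exact: (@finite_measure_integrable_cst _ _ _ m setT 1).
have [_ _ _ _ [fub _]] := Fubini_dominated M mf i1
  f1.
have -> : \int[m]_y expR (- s ^+ 2 * dotp (x - y) (x - y) / 2) = \int[m]_y \int[M]_xi f (xi, y).
  apply: eq_Rintegral => y _; rewrite -(hM (x - y)).1.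
  by apply: eq_Rintegral => xi _; rewrite fE.
rewrite -fub; apply: eq_Rintegral => xi _.
have mdot : measurable_fun setT (fun y : 'rV[R]_d => dotp xi y) by exact: measurable_dotp.
have ic : m.-integrable setT (EFin \o (fun y => cos (dotp xi y))).
  by apply: (@finite_bounded_integrable _ _ _ m _ 1) => [|y];
    [exact: measurable_cos mdot|exact: cos_max].
have isn : m.-integrable setT (EFin \o (fun y => sin (dotp xi y))).
  by apply: (@finite_bounded_integrable _ _ _ m _ 1) => [|y];
    [exact: measurable_sin mdot|exact: sin_max].
rewrite /f /= RintegralD//; [|exact: integrable_mulrl|exact: integrable_mulrl].
by rewrite !RintegralZl// mcos msin mulr0 addr0.
Qed.

(** * Translation invariance of Lebesgue measure on R^d *)

Section translation.
Context (R : realType).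

Lemma lebesgue_measure_translate (a : R) (A : set (measurableTypeR R)) : measurable A ->
  lebesgue_measure A = lebesgue_measure ((fun y : measurableTypeR R => y + a) @^-1` A).
Proof.
move=> mA.
have mt : measurable_fun setT (fun y : measurableTypeR R => y + a : measurableTypeR R).
  exact: measurable_funD.
pose t : {mfun measurableTypeR R >-> measurableTypeR R} :=
  HB.pack (fun y : measurableTypeR R => y + a : measurableTypeR R)
    (isMeasurableFun.Build _ _ _ _ _ mt).
apply: (lebesgue_measure_unique (mu := pushforward lebesgue_measure t)) => //.
move=> _ [[b c] _ <-].
transitivity (@lebesgue_measure R `](b - a), (c - a)]%classic); last first.
  rewrite /pushforward; congr lebesgue_measure.
  by apply/seteqP; split => y /=; rewrite !in_itv/= ltrBlDr lerBrDr.
rewrite !lebesgue_measure_itv/= !lte_fin ltrD2r; case: ifP => // _.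
by rewrite -!EFinB opprB addrA subrK.
Qed.

Lemma measurable_addr_rV d (x : 'rV[R]_d) : measurable_fun setT (fun y : 'rV[R]_d => y + x).
Proof.
apply: measurable_fun_rV => i; under eq_fun do rewrite mxE.
by apply: measurable_funD => //; exact: measurable_coord_rV.
Qed.

(** The measure is built one coordinate at a time, hence the induction. A translation acts on each
    factor of the product separately, and a measure on the product is determined by its values on
    rectangles. *)
Lemma lebesgue_rV_translate d (x : 'rV[R]_d) (A : set 'rV[R]_d) : measurable A ->
  lebesgue_rV R d A = lebesgue_rV R d ((fun y => y + x) @^-1` A).
Proof.
elim: d x A => [|d IH] x A mA.
  congr (lebesgue_rV R 0 _); apply/seteqP; split => y /=;
  by rewrite (_ : y + x = y)//; apply/rowP => -[].
pose T := (measurableTypeR R * 'rV[R]_d)%type.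
pose x0 := x 0 ord0; pose x' := (uncons_rV x).2.
pose tau (z : T) : T := (z.1 + x0, z.2 + x').
have mtau : measurable_fun setT tau.
  apply: measurable_fun_pair.
    by apply: measurable_funD => //; exact: measurable_fst.
  apply: measurable_fun_rV => i; under eq_fun do rewrite mxE.
  apply: measurable_funD => //.
  by apply: (measurableT_comp (measurable_coord_rV i)); exact: measurable_snd.
have mtr := measurable_addr_rV x'.
have key := @product_measure_unique _ _ _ _ R (@lebesgue_measure R) (lebesgue_rV R d)
  (pushforward (@lebesgue_measure R \x lebesgue_rV R d)%E tau).
rewrite /= /lebesgue_rV_step /pushforward (key mtau); last 2 first.
- move=> B C mB mC.
  have mt : measurable_fun setT (fun y : measurableTypeR R => y + x0 : measurableTypeR R).
    exact: measurable_funD.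
  transitivity (@lebesgue_measure R ((fun y : measurableTypeR R => (y + x0)%R) @^-1` B) *
      lebesgue_rV R d ((fun y => (y + x')%R) @^-1` C))%E.
    apply: product_measure1E.
      by have := mt measurableT _ mB; rewrite setTI.
    by have := mtr measurableT _ mC; rewrite setTI.
  by congr (_ * _)%E; apply/esym; [exact: lebesgue_measure_translate|exact: IH].
- by have := measurable_cons_rV measurableT mA; rewrite setTI.
congr product_measure1; apply/seteqP; split => z /=;
rewrite (_ : cons_rV (z.1 + x0, z.2 + x') = cons_rV z + x)//;
  by apply/rowP => i; rewrite !mxE; case: unliftP => [j ->|->]//=; rewrite mxE mxE.
Qed.

End translation.

(** * The Gaussian kernel as an approximate identity *)

Section approximate_identity.
Context (R : realType) (d : nat).
Notation L := (lebesgue_rV R d).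
Implicit Types (x y z : 'rV[R]_d) (s r : R).

Definition gaussian_kernel s z : R := expR (- s ^+ 2 * dotp z z / 2).

(** The ball of the sup norm: it fits the topology of the row vectors, and its volume is a product
    of interval lengths. *)
Definition box x r : set 'rV[R]_d := [set y | forall i, `|x 0 i - y 0 i| < r].

Lemma gaussian_kernelN s z : gaussian_kernel s (- z) = gaussian_kernel s z.
Proof. by rewrite /gaussian_kernel dotpNr dotpC dotpNr opprK. Qed.

Lemma gaussian_kernel_ge0 s z : 0 <= gaussian_kernel s z.
Proof. exact: expR_ge0. Qed.

Lemma gaussian_kernel_le1 s z : gaussian_kernel s z <= 1.
Proof.
rewrite expR_le1 mulNr mulNr oppr_le0 mulr_ge0// mulr_ge0 ?sqr_ge0//.
exact: dotp_ge0.
Qed.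

Lemma measurable_gaussian_kernel d0 (T : measurableType d0) s (f : T -> 'rV[R]_d) :
  measurable_fun setT f -> measurable_fun setT (fun t => gaussian_kernel s (f t)).
Proof.
move=> mf; rewrite /gaussian_kernel; apply: measurableT_comp => //.
apply: measurable_funM => //.
by apply: measurable_funM => //; exact: measurable_dotp.
Qed.

Lemma measurable_subl_rV x : measurable_fun setT (fun y => x - y).
Proof.
apply: measurable_fun_rV => i; under eq_fun do rewrite !mxE.
by apply: measurable_funB => //; exact: measurable_coord_rV.
Qed.

Let itv_box x r i : set (measurableTypeR R) := `](x 0 i - r), (x 0 i + r)[%classic.

Let boxE x r : box x r = [set y | forall i, itv_box x r i (y 0 i)].
Proof.
apply/seteqP; split => y /= h i; have := h i; rewrite /itv_box/= in_itv/= ltr_distlC//.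
Qed.

Lemma measurable_box x r : measurable (box x r).
Proof.
rewrite (_ : box x r = \bigcap_(i in [set: 'I_d]) [set y | itv_box x r i (y 0 i)]).
  apply: fin_bigcap_measurable => // i _.
  have := @measurable_coord_rV R d i measurableT (itv_box x r i).
  by rewrite setTI; apply; exact: measurable_itv.
by rewrite boxE; apply/seteqP; split => [y h i _|y h i]; exact: h.
Qed.

Lemma lebesgue_rV_of_box x r : 0 < r -> L (box x r) = ((2 * r) ^+ d)%:E.
Proof.
move=> r0; rewrite boxE lebesgue_rV_box; last by move=> i; exact: measurable_itv.
rewrite (eq_bigr (fun=> (2 * r)%:E)) => [|i _].
  by rewrite prodEFin prodr_const card_ord.
rewrite /itv_box lebesgue_measure_itv/= lte_fin ifT; last by lra.
by rewrite -EFinB; congr EFin; ring.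
Qed.

(** Makes the mass of the kernel near its centre the same for all centres, so that it cancels when
    two points are compared. *)
Lemma box_kernel_translate x r s :
  (\int[L]_(y in box x r) (gaussian_kernel s (x - y))%:E =
   \int[L]_(y in box 0 r) (gaussian_kernel s y)%:E)%E.
Proof.
have mt := measurable_addr_rV x.
pose tau : {mfun 'rV[R]_d >-> 'rV[R]_d} :=
  HB.pack (fun y : 'rV[R]_d => y + x) (isMeasurableFun.Build _ _ _ _ _ mt).
transitivity (\int[pushforward L tau]_(y in box x r) (gaussian_kernel s (x - y))%:E)%E.
  by apply: eq_measure_integral => A mA _; exact: lebesgue_rV_translate.
rewrite [LHS]ge0_integral_pushforward//; [|exact: measurable_box| |].
- rewrite (_ : _ @^-1` _ = box 0 r).
    by apply: eq_integral => y _ /=; rewrite opprD addrCA subrr addr0 gaussian_kernelN.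
  apply/seteqP; split => y /= h i; have := h i; rewrite !mxE opprD addrCA subrr addr0 ?sub0r//.
- apply/measurable_funTS/measurable_EFinP/measurable_gaussian_kernel.
  exact: measurable_subl_rV.
- by move=> y _; rewrite lee_fin gaussian_kernel_ge0.
Qed.

Variables (m : probability 'rV[R]_d R) (f : 'rV[R]_d -> R).
Hypothesis density : continuous_density m f.

Let f_ge0 y : 0 <= f y. Proof. by have [] := density. Qed.

Let mf : measurable_fun setT f.
Proof.
have [cf _ _] := density.
apply: (measurability _ (RGenOpens.measurableE R)) => //.
move=> _ [_ [a [b ->]] <-]; rewrite setTI; apply: sub_sigma_algebra.
by apply: open_comp; [move=> v _; exact: cf|exact: interval_open].
Qed.

Let mk s x : measurable_fun setT (fun y => gaussian_kernel s (x - y)).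
Proof. by apply: measurable_gaussian_kernel; exact: measurable_subl_rV. Qed.

Let densityE s x : (\int[m]_y (gaussian_kernel s (x - y))%:E =
  \int[L]_y (gaussian_kernel s (x - y) * f y)%:E)%E.
Proof.
have [_ _ mE] := density.
by apply: (integral_density mf f_ge0 mE) => // y; exact: gaussian_kernel_ge0.
Qed.

Let smoothE s x : (\int[m]_y gaussian_kernel s (x - y))%:E =
  (\int[m]_y (gaussian_kernel s (x - y))%:E)%E.
Proof.
rewrite fineK//; apply: integrable_fin_num => //.
apply: (@finite_bounded_integrable _ _ _ m _ 1) => // y.
by rewrite ger0_norm ?gaussian_kernel_ge0 ?gaussian_kernel_le1.
Qed.

Definition kernel_mass s r := \int[L]_(y in box 0 r) gaussian_kernel s y.

Lemma kernel_massE s r : 0 < r -> (kernel_mass s r)%:E =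
  (\int[L]_(y in box 0 r) (gaussian_kernel s y)%:E)%E.
Proof.
move=> r0; rewrite fineK// ge0_fin_numE; last first.
  by apply: integral_ge0 => y _; rewrite lee_fin gaussian_kernel_ge0.
have mg : measurable_fun setT (gaussian_kernel s) by exact: measurable_gaussian_kernel.
apply: (@le_lt_trans _ _ (\int[L]_(y in box 0 r) 1)%E).
  apply: ge0_le_integral => //; first exact: measurable_box.
  - by move=> y _; rewrite lee_fin gaussian_kernel_ge0.
  - exact/measurable_funTS/measurable_EFinP.
  - by move=> y _; rewrite lee_fin gaussian_kernel_le1.
rewrite integral_cst ?mul1e; last exact: measurable_box.
by rewrite [X in (X < _)%E](lebesgue_rV_of_box 0 r0) ltry.
Qed.

Let mkf s x : measurable_fun setT (fun y => gaussian_kernel s (x - y) * f y).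
Proof. exact: measurable_funM. Qed.

Let kf_ge0 s x y : 0 <= gaussian_kernel s (x - y) * f y.
Proof. by rewrite mulr_ge0 ?gaussian_kernel_ge0. Qed.

Lemma smooth_ge s x r c : 0 < r -> 0 <= c -> (forall y, box x r y -> c <= f y) ->
  c * kernel_mass s r <= \int[m]_y gaussian_kernel s (x - y).
Proof.
move=> r0 c0 cf; rewrite -lee_fin EFinM kernel_massE// smoothE densityE.
have mb := measurable_box x r.
rewrite -(box_kernel_translate x) -ge0_integral_mulrl//; last first.
  by move=> y; exact: gaussian_kernel_ge0.
apply: (@le_trans _ _ (\int[L]_(y in box x r) (gaussian_kernel s (x - y) * f y)%:E)%E).
  apply: ge0_le_integral_EFin => //.
  - exact: measurable_funM.
  - by move=> y; rewrite mulr_ge0 ?gaussian_kernel_ge0.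
  - by move=> y yx; rewrite mulrC ler_wpM2l ?gaussian_kernel_ge0 ?cf.
apply: ge0_subset_integral => //; first exact/measurable_EFinP.
by move=> y _; rewrite lee_fin.
Qed.

(** Outside the box |x - y| >= r, where the kernel is at most e^{- s^2 r^2 / 2}, and [m] has total
    mass 1. *)
Lemma smooth_le s x r c : 0 < r -> 0 <= c -> (forall y, box x r y -> f y <= c) ->
  \int[m]_y gaussian_kernel s (x - y) <= c * kernel_mass s r + expR (- s ^+ 2 * r ^+ 2 / 2).
Proof.
move=> r0 c0 fc; rewrite -lee_fin EFinD EFinM kernel_massE// smoothE densityE.
have mb := measurable_box x r; have mbC := measurableC mb.
rewrite -(setUv (box x r)) ge0_integral_setU//; last 3 first.
- by rewrite setUv; exact/measurable_EFinP.
- by move=> y _; rewrite lee_fin.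
- by apply/disj_setPCl.
apply: leeD.
  rewrite -(box_kernel_translate x) -ge0_integral_mulrl//; last first.
    by move=> y; exact: gaussian_kernel_ge0.
  apply: ge0_le_integral_EFin => //; first exact: measurable_funM.
  by move=> y yx; rewrite mulrC ler_wpM2r ?gaussian_kernel_ge0 ?fc.
have [_ _ mE] := density.
set e := expR _; have e0 : 0 <= e by exact: expR_ge0.
apply: (@le_trans _ _ (e%:E * m (~` box x r))%E); last first.
  rewrite -[leRHS]mule1 lee_wpmul2l ?lee_fin//.
  exact: probability_le1 mbC.
rewrite mE// -ge0_integral_mulrl//.
apply: ge0_le_integral_EFin => //; first exact: measurable_funM.
move=> y /= nyx; rewrite ler_wpM2r// ler_expR !mulNr lerN2.
rewrite ler_pM2r// ler_wpM2l ?sqr_ge0//.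
move: nyx => /existsNP[i /negP]; rewrite -leNgt => ri.
rewrite -sqr_enorm lerXn2r ?nnegrE ?enorm_ge0 ?(ltW r0)// (le_trans ri)//.
by rewrite (le_trans _ (coord_le_enorm _ i))// !mxE.
Qed.

End approximate_identity.

(** On the box of radius rho = r / (d + 2) one has |y|^2 <= d rho^2 <= r^2 / 2, so the kernel is at
    least e^{- s^2 r^2 / 4}. This rate is half that of the tail in [smooth_le], so the tail is
    negligible against the mass as s grows. *)
Lemma kernel_mass_ge (R : realType) d (s r : R) : 0 < r ->
  expR (- s ^+ 2 * r ^+ 2 / 4) * (2 * (r / d.+2%:R)) ^+ d <= kernel_mass d s r.
Proof.
move=> r0; set rho := r / _.
have rho0 : 0 < rho by rewrite divr_gt0.
have rhor : rho <= r by rewrite ler_pdivrMr// ler_peMr ?(ltW r0)// ler1n.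
rewrite -lee_fin EFinM kernel_massE// -(lebesgue_rV_of_box 0 rho0).
have mb := measurable_box (0 : 'rV[R]_d) rho.
rewrite -integral_cst//.
have mg : measurable_fun setT (gaussian_kernel (d := d) s) by exact: measurable_gaussian_kernel.
apply: (@le_trans _ _ (\int[lebesgue_rV R d]_(y in box 0 rho) (gaussian_kernel s y)%:E)%E).
  apply: ge0_le_integral_EFin => // y yb.
  rewrite ler_expR !mulNr lerN2 -[leLHS]mulrA -[leRHS]mulrA ler_wpM2l ?sqr_ge0//.
  have yi i : y 0 i * y 0 i <= rho ^+ 2.
    have := yb i; rewrite mxE sub0r normrN => /ltW yr.
    by rewrite -expr2 -[leLHS]real_normK ?num_real// lerXn2r ?nnegrE// ltW.
  have : dotp y y <= d%:R * rho ^+ 2.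
    rewrite /dotp (le_trans (ler_sum _ (fun i _ => yi i)))//.
    by rewrite sumr_const card_ord mulr_natl.
  have -> : r = rho * (d%:R + 2) by rewrite /rho -natrD addn2 divfK.
  have := ler0n R d; move: (dotp y y) (d%:R) (sqr_ge0 rho) => q n.
  have -> : (rho * (n + 2)) ^+ 2 = rho ^+ 2 * (n + 2) ^+ 2 by ring.
  move: (rho ^+ 2) => w w0 n0 h.
  rewrite (le_trans (ler_wpM2r _ h))//.
  have : 0 <= w * (n * n) by rewrite !mulr_ge0.
  by rewrite expr2; nra.
apply: ge0_subset_integral => //.
- exact: measurable_box.
- by apply/measurable_funTS/measurable_EFinP.
- by move=> y _; rewrite lee_fin expR_ge0.
- by move=> y h i; exact: lt_le_trans (h i) rhor.
Qed.

Lemma continuous_box (R : realType) d (f : 'rV[R]_d -> R) x e : continuous f -> 0 < e ->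
  exists2 r, 0 < r & forall y, box x r y -> `|f x - f y| < e.
Proof.
move=> cf e0; have /cvgrPdist_lt/(_ _ e0) := cf x.
move=> /nbhs_ballP[r /= r0 rf]; exists r => // y xy; apply: rf.
by split => // i j; rewrite (ord1 i); exact: xy.
Qed.

(** By continuity [f] is within e of f(x) and of f(z) on boxes of a common radius around these
    points. Dividing the smoothed inequality by the kernel mass and letting s tend to infinity, then
    e to 0, leaves the pointwise one. *)
Lemma density_le_of_smooth_le (R : realType) d (m : probability 'rV[R]_d R)
    (f : 'rV[R]_d -> R) (x z : 'rV[R]_d) (C D : R) :
  continuous_density m f -> 0 <= C ->
  (forall s, 0 < s -> \int[m]_y gaussian_kernel s (x - y) <=
    expR (D / s ^+ 2) * C * \int[m]_y gaussian_kernel s (z - y)) ->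
  f x <= C * f z.
Proof.
move=> density C0 le_smooth.
have [cf f0 _] := density.
have key e : 0 < e -> f x - e <= C * (f z + e).
  move=> e0.
  have [r1 r10 fr1] := continuous_box x cf e0.
  have [r2 r20 fr2] := continuous_box z cf e0.
  (* [smooth_ge] asks for a nonnegative lower bound; a negative one makes the claim trivial. *)
  have [fxe|/ltW fxe] := leP 0 (f x - e); last first.
    by rewrite (le_trans fxe)// mulr_ge0// addr_ge0// ltW.
  pose r := Num.min r1 r2.
  have r0 : 0 < r by rewrite lt_min r10.
  have lo y : box x r y -> f x - e <= f y.
    move=> h; have /fr1 : box x r1 y by move=> i; rewrite (lt_le_trans (h i))// ge_min lexx.
    by rewrite ltr_distlC => /andP[/ltW].
  have hi y : box z r y -> f y <= f z + e.
    move=> h; have /fr2 : box z r2 y by move=> i; rewrite (lt_le_trans (h i))// ge_min lexx orbT.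
    by rewrite ltr_distlC => /andP[_ /ltW].
  have fze : 0 <= f z + e by rewrite addr_ge0// ltW.
  pose V := (2 * (r / d.+2%:R)) ^+ d.
  have V0 : 0 < V by rewrite exprn_gt0// mulr_gt0// divr_gt0.
  pose E (s : R) := expR (- s ^+ 2 * r ^+ 2 / 4).
  have bound s : 0 < s -> f x - e <= expR (D / s ^+ 2) * C * (f z + e + E s / V).
    move=> s0; have mass := kernel_mass_ge d s r0; rewrite -/V -/(E s) in mass.
    have E0 : 0 < E s by exact: expR_gt0.
    have M0 : 0 < kernel_mass d s r by rewrite (lt_le_trans _ mass)// mulr_gt0.
    rewrite -(ler_pM2r M0) (le_trans (smooth_ge density s r0 fxe lo))//.
    rewrite (le_trans (le_smooth s s0))// -[leRHS]mulrA ler_wpM2l ?mulr_ge0 ?expR_ge0//.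
    rewrite (le_trans (smooth_le density s r0 fze hi))// [leRHS]mulrDl lerD2l.
    (* The tail is E^2 = (E / V) (E V), and E V is at most the kernel mass. *)
    have -> : expR (- s ^+ 2 * r ^+ 2 / 2) = E s / V * (E s * V).
      have -> : E s / V * (E s * V) = E s * E s.
        by rewrite mulrACA mulVf ?mulr1// gt_eqF.
      by rewrite /E -expRD; congr expR; field.
    by rewrite ler_wpM2l// divr_ge0 ?(ltW E0) ?(ltW V0).
  have cvg : (fun n : nat => expR (D / n.+1%:R ^+ 2) * C * (f z + e + E n.+1%:R / V)) @ \oo -->
      C * (f z + e).
    have hn : (fun n : nat => (n.+1%:R^-1 : R)) @ \oo --> 0 by exact: cvg_harmonic.
    have hE : (fun n : nat => E n.+1%:R) @ \oo --> 0.
      (* Again e^{-u} <= 1 / u, with u = n^2 r^2 / 4, and n^2 >= n. *)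
      apply: (@squeeze_cvgr _ _ _ _ (cst 0) (fun n : nat => 4 / r ^+ 2 * n.+1%:R^-1)).
      - near=> n; rewrite expR_ge0/= /E mulNr mulNr expRN.
        have rr0 : 0 < r ^+ 2 by rewrite exprn_gt0.
        rewrite -[leRHS]invrK lef_pV2 ?posrE ?expR_gt0 ?invr_gt0 ?divr_gt0//.
        rewrite (le_trans _ (expR_ge1Dx _))// ler_wpDl//.
        rewrite invfM invrK invf_div mulrC -[leRHS]mulrA ler_wpM2r ?divr_ge0 ?(ltW rr0)//.
        by rewrite expr2 ler_peMr// ler1n.
      - exact: cvg_cst.
      - by rewrite -(mulr0 (4 / r ^+ 2)); apply: cvgM => //; exact: cvg_cst.
    have -> : C * (f z + e) = 1 * C * (f z + e + 0 * V^-1) by rewrite mul1r mul0r addr0.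
    apply: cvgM.
      apply: cvgM; last exact: cvg_cst.
      rewrite -[X in _ --> X]expR0; apply: continuous_cvg; first exact: continuous_expR.
      rewrite -[X in _ --> X](mulr0 D); apply: cvgM; first exact: cvg_cst.
      rewrite -[X in _ --> X](mulr0 0); under eq_fun do rewrite expr2 invfM.
      exact: cvgM.
    by apply: cvgD; [exact: cvg_cst|apply: cvgM => //; exact: cvg_cst].
  by apply: (ler_cvg_to (cvg_cst (f x - e)) cvg); apply: nearW => n; exact: bound.
apply/ler_addgt0Pr => e e0.
(* [key] loses e on the left and C e on the right, hence the choice e / (1 + C). *)
have C1 : 0 < 1 + C by rewrite ltr_pwDl.
have := key (e / (1 + C)) (divr_gt0 e0 C1).
rewrite lerBlDr => /le_trans; apply; rewrite le_eqVlt; apply/orP; left; apply/eqP.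
by field; rewrite gt_eqF.
Unshelve. all: by end_near. Qed.

(** * The pointwise bound for the transition density *)

Unset Implicit Arguments.
Set Strict Implicit.

Theorem theorem3p5 (R : realType) (d : nat)
  (nu : {measure set 'rV[R]_d -> \bar R})
  (nu_levy : symmetric_levy_measure nu)
  (mu : R -> probability 'rV[R]_d R)
  (mu_semigroup : convolution_semigroup mu)
  (mu_char : forall (t : R) (xi : 'rV[R]_d), 0 <= t ->
     complex_integral (mu t) (fun y => expi (dotp xi y)) =
     real_complex R (expR (- t * levy_exponent nu xi)))
  (Psi_int : forall t : R, 0 < t ->
     (\int[lebesgue_rV R d]_z (expR (- t * levy_exponent nu z))%:E < +oo)%E)
  (p : R -> 'rV[R]_d -> R)
  (p_density : forall t : R, 0 < t -> continuous_density (mu t) (p t))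
  (xi0 : 'rV[R]_d)
  (xi0_moment :
     (\int[nu]_(y in [set y | (1 <= enorm y)%R]) (expR (dotp xi0 y))%:E
        < +oo)%E) :
  forall (x : 'rV[R]_d) (t : R), 0 < t ->
    p t x <= p t 0 * expR (- dotp xi0 x + t * levy_omega nu xi0).
Proof.
move=> x t t0.
have t_ge0 := ltW t0.
have char_cos xi : \int[mu t]_y cos (dotp xi y) = expR (- t * levy_exponent nu xi).
  by have := congr1 (@complex.Re R) (mu_char t xi t_ge0).
have char_sin xi : \int[mu t]_y sin (dotp xi y) = 0.
  by have := congr1 (@complex.Im R) (mu_char t xi t_ge0).
(* This [D] makes e^{D / s^2} the constant K of the completed square. *)
rewrite mulrC; apply: (density_le_of_smooth_le (p_density t t0) (D := dotp xi0 xi0 / 2)).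
  exact: expR_ge0.
move=> s s0; have [M hM] := gaussian_rV s0 d.
(* The smoothed density at z becomes a frequency integral, to which [levy_shift_bound] applies at z
   = x, with z = 0 on its right side. *)
have E z : \int[mu t]_y gaussian_kernel s (z - y) =
    \int[M]_xi (cos (dotp xi z) * expR (- t * levy_exponent nu xi)).
  by rewrite (gaussian_parseval hM char_cos char_sin).
rewrite !E.
have -> : \int[M]_xi (cos (dotp xi 0) * expR (- t * levy_exponent nu xi)) =
    \int[M]_xi expR (- t * levy_exponent nu xi).
  apply: eq_Rintegral => xi _; rewrite (_ : dotp xi 0 = 0) ?cos0 ?mul1r//.
  by rewrite /dotp big1// => i _; rewrite mxE mulr0.
have -> : dotp xi0 xi0 / 2 / s ^+ 2 = dotp xi0 xi0 / (2 * s ^+ 2) by rewrite -mulrA -invfM.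
exact: (levy_shift_bound nu_levy xi0_moment (lt0r_neq0 s0) hM).
Qed.
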